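(* Let $n\ge 1$ and let $S$ be the unit sphere of $\mathbb{C}^n$. A set $\Omega\subset Q$ is a $C(S)$-algebra pattern if and only if $\Omega$ is an $L^\infty(S)$-algebra pattern.
   Context: $\sigma$ is the unique rotation-invariant (i.e. $O(2n)$-invariant) Borel probability measure on $S$, and $L^p(S)=L^p(S,\sigma)$ (complex-valued). $C(S)$ is the space of complex continuous functions on $S$ with the uniform norm. The weak*-topology on $L^\infty(S)$ is the one it carries as the dual of $L^1(S)$, via the functionals $f\mapsto\int_S fg\,d\sigma$, $g\in L^1(S)$. $Q$ is the set of pairs $(p,q)$ of nonnegative integers. For $(p,q)\in Q$, $H(p,q)$ is the space of restrictions to $S$ of harmonic polynomials on $\mathbb{C}^n$ that are homogeneous of degree $p$ in $z_1,\dots,z_n$ and homogeneous of degree $q$ in $\bar z_1,\dots,\bar z_n$. For $\Omega\subset Q$, $E_\Omega$ is the set of all finite sums of elements of the spaces $H(p,q)$ with $(p,q)\in\Omega$ ($E_\emptyset=\{0\}$). $\overline{E}_\Omega$ is the uniform closure of $E_\Omega$ in $C(S)$, and $\overline{E}_\Omega^{*}$ is the weak*-closure of $E_\Omega$ in $L^\infty(S)$. $\Omega$ is a $C(S)$-algebra pattern if $\overline{E}_\Omega$ is an algebra, and an $L^\infty(S)$-algebra pattern if $\overline{E}_\Omega^{*}$ is an algebra, where ''algebra'' means a linear subspace closed under pointwise multiplication (it need not contain the constants). *)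

(* Defs.v *)
From HB Require Import structures.
From mathcomp Require Import all_boot all_order all_algebra.
(* The notations of mpoly clash with those of MathComp-Analysis. *)
From mathcomp Require Import -(notations) mpoly.
From mathcomp Require Import all_classical all_reals all_analysis.
From mathcomp Require Import complex.

Set Implicit Arguments.
Unset Strict Implicit.
Unset Printing Implicit Defensive.

Import Order.TTheory GRing.Theory Num.Theory.
Import numFieldNormedType.Exports.

Local Open Scope classical_set_scope.
Local Open Scope ring_scope.
Local Open Scope complex_scope.

(* The usual topology of C. The library defines it on K^o for every
   numFieldType K, but does not find it on the concrete type R[i]. *)
HB.instance Definition _ (R : realType) := NormedModule.copy R[i] R[i]^o.

(* The index n stands for the complex dimension n + 1 >= 1. *)

Definition sphere_set (R : realType) (n : nat) : set 'rV[R[i]]_n.+1 :=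
  [set z | \sum_(j < n.+1) `|z ord0 j| ^+ 2 = 1].
Arguments sphere_set : clear implicits.

Definition sphere (R : realType) (n : nat) : Type :=
  set_type (sphere_set R n).

Definition zcoord (R : realType) (n : nat) (z : sphere R n) (j : 'I_n.+1) :
  R[i] := (set_val z : 'rV[R[i]]_n.+1) ord0 j.

Section sphere_structures.
Variables (R : realType) (n : nat).

Lemma sphere_basepoint :
  (delta_mx ord0 ord0 : 'rV[R[i]]_n.+1) \in sphere_set R n.
Proof.
apply/mem_set; rewrite /sphere_set /= (bigD1 ord0) //= mxE !eqxx /=.
rewrite normr1 expr1n big1 ?addr0 // => j /negPf j0.
by rewrite mxE j0 andbF normr0 expr0n.
Qed.

(* Subspace topology, and its Borel sigma-algebra. *)
HB.instance Definition _ :=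
  Topological.copy (sphere R n) (set_type (sphere_set R n)).
HB.instance Definition _ := isPointed.Build (sphere R n)
  (SigSub sphere_basepoint : set_type (sphere_set R n)).
HB.instance Definition _ :=
  Measurable.copy (sphere R n) (g_sigma_algebraType (@open (sphere R n))).

End sphere_structures.

(* The identification of C^(n+1) with R^(2n+2): (z_j) |-> ((Re z_j), (Im z_j)). *)
Definition real_coords (R : realType) (n : nat) (z : sphere R n) :
    'rV[R]_(n.+1 + n.+1) :=
  row_mx (\row_j complex.Re (zcoord z j)) (\row_j complex.Im (zcoord z j)).

(* O(2n+2)-invariance: [g] is the action on the sphere of the orthogonal
   matrix [A]. *)
Definition rotation_invariant (R : realType) (n : nat)
    (sigma : probability (sphere R n) R) : Prop :=
  forall (A : 'M[R]_(n.+1 + n.+1)) (g : sphere R n -> sphere R n),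
    A *m A^T = 1%:M ->
    (forall z, real_coords (g z) = real_coords z *m A) ->
    forall B : set (sphere R n), measurable B -> sigma (g @^-1` B) = sigma B.

Section polynomials.
Variables (R : realType) (n : nat).
Notation C := R[i].
(* The variables come in two blocks: [lshift _ j] and [rshift _ j] index z_j
   and conj z_j, or x_j and y_j, where z_j = x_j + i y_j. *)
Notation poly2 := (mpoly (n.+1 + n.+1) C).
Notation var k := (mpolyX C (mnm1 k)).

Definition bihomogeneous (p q : nat) (P : poly2) : Prop :=
  forall m : multinom (n.+1 + n.+1), m \in msupp P ->
    (\sum_(j < n.+1) m (lshift n.+1 j) = p)%N /\
    (\sum_(j < n.+1) m (rshift n.+1 j) = q)%N.

Definition z_in_xy (k : 'I_(n.+1 + n.+1)) : poly2 :=
  match fintype.split k with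
  | inl j => var (lshift n.+1 j) + 'i%C *: var (rshift n.+1 j)
  | inr j => var (lshift n.+1 j) - 'i%C *: var (rshift n.+1 j)
  end.

Definition to_xy (P : poly2) : poly2 :=
  comp_mpoly [tuple z_in_xy k | k < n.+1 + n.+1] P.

(* The Laplacian of R^(2n+2), on polynomials in the x_j and y_j. *)
Definition laplacian (P : poly2) : poly2 :=
  \sum_(k < n.+1 + n.+1) mderiv k (mderiv k P).

Definition eval_sphere (P : poly2) (z : sphere R n) : C :=
  meval (fun k => match fintype.split k with
                  | inl j => zcoord z j
                  | inr j => (zcoord z j)^*
                  end) P.

Definition H (p q : nat) : set (sphere R n -> C) :=
  [set f | exists P : poly2,
     [/\ bihomogeneous p q P, laplacian (to_xy P) = 0 & f = eval_sphere P]].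

Definition E (Omega : set (nat * nat)) : set (sphere R n -> C) :=
  [set f | exists (k : nat) (h : 'I_k -> sphere R n -> C),
     (forall i, exists2 pq, Omega pq & H pq.1 pq.2 (h i)) /\
     f = \sum_(i < k) h i].

End polynomials.

Arguments H : clear implicits.
Arguments E : clear implicits.

Definition is_algebra (T : Type) (K : pzRingType) (A : set (T -> K)) : Prop :=
  [/\ A (fun=> 0),
      forall f g, A f -> A g -> A (fun x => f x + g x),
      forall c f, A f -> A (fun x => c * f x)
    & forall f g, A f -> A g -> A (fun x => f x * g x)].

(* The closure in C(S), as the trace on C(S) of the closure for the uniform
   topology on all functions. *)
Definition uniform_closure (R : realType) (n : nat)
    (A : set (sphere R n -> R[i])) : set (sphere R n -> R[i]) :=
  [set f | continuous f] `&` closure (A : set {uniform sphere R n -> R[i]}).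

Definition C_algebra_pattern (R : realType) (n : nat)
    (Omega : set (nat * nat)) : Prop :=
  is_algebra (uniform_closure (E R n Omega)).

Section weak_star.
Context d (T : measurableType d) (R : realType).
Variable mu : {measure set T -> \bar R}.
Notation C := R[i].

(* Elements of L^p are represented by functions instead of classes modulo
   null sets. Functions equal almost everywhere are topologically
   indistinguishable below, so that weak-star closures are saturated. *)
Definition Lp (p : \bar R) : set (T -> C) :=
  [set f : T -> C |
     [/\ measurable_fun [set: T] (fun x => complex.Re (f x)),
         measurable_fun [set: T] (fun x => complex.Im (f x))
       & ('N[mu]_p[ (fun x => (Normc.normc (f x))%:E) ] < +oo)%E]].

Definition cintegral (f : T -> C) : C :=
  (\int[mu]_x complex.Re (f x)) +i* (\int[mu]_x complex.Im (f x)).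

Definition pairing (f : set_type (Lp +oo)) :
    {ptws set_type (Lp 1%:E) -> C} :=
  fun g => cintegral (fun x => set_val f x * set_val g x).

(* The initial topology for [pairing] is the coarsest one for which every
   functional f |-> \int f g dmu, with g in L^1, is continuous. *)
Definition weak_star_closure (A : set (T -> C)) : set (T -> C) :=
  set_val @` closure (set_val @^-1` A : set (initial_topology pairing)).

End weak_star.

Definition Linfty_algebra_pattern (R : realType) (n : nat)
    (sigma : probability (sphere R n) R) (Omega : set (nat * nat)) : Prop :=
  is_algebra (weak_star_closure sigma (E R n Omega)).

(* Main.v *)
(* Both conditions are equivalent to: E_Omega is closed under products. Indeed
   multiplication is jointly continuous for the uniform norm and separately
   continuous for the weak-star topology, so that both closures of an algebra
   are algebras. Conversely, a product h of two elements of E_Omega is a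
   polynomial, hence a finite sum of h_pq in H(p,q); if h lies in one of the
   closures, then each h_pq with (p,q) outside Omega is orthogonal to all
   polynomials, and so vanishes.
   Orthogonality and this last non-degeneracy rely on a single identity, which
   invariance under infinitesimal unitary maps gives without any computation of
   surface measure, for d_j = d/dz_j and F of degree q in conj z:
     int d_j F = (n + 1 + q) int conj(z_j) F. *)
From HB Require Import structures.
Require Import Defs.
From mathcomp Require Import all_boot all_order all_algebra.
From mathcomp Require Import -(notations) mpoly.
From mathcomp Require Import all_classical all_reals all_analysis.
From mathcomp Require Import complex measurable_realfun ess_sup_inf.
From mathcomp Require Import ring lra.

Set Implicit Arguments.
Unset Strict Implicit.
Unset Printing Implicit Defensive.

Import Order.TTheory GRing.Theory Num.Theory.
Import numFieldNormedType.Exports.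

Local Open Scope classical_set_scope.
Local Open Scope ring_scope.
Local Open Scope complex_scope.

(** Everything is done with formal polynomials in the z_j and conj z_j, because derivatives act on
    them and not on functions on the sphere. Restriction to the sphere is not injective, since |z|^2
    - 1 restricts to 0; so the integral enters as a linear functional L with L(|z|^2 F) = L F, and
    vanishing is deduced for bihomogeneous polynomials only. The pairing L(F G) has no conjugation,
    hence matches H(p,q) with H(q,p). The infinitesimal invariance of L is obtained without
    differentiating under the integral and without matrix exponentials: the unitary maps z -> z + (w
    - 1)(z . conj v) v, with v a unit vector and |w| = 1, change a polynomial by t times a
    first-order term up to a uniform O(t^2), so t times the integral of that term is O(t^2) for all
    small t. Polarization in v then isolates each field [zv k * dz j - zbv j * dzb k]. Both closures
    are used through one consequence: the integrals of h against a given polynomial are approximated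
    by those of elements of E_Omega. *)

Local Notation dz j := (mderiv (lshift _ j)).
Local Notation dzb j := (mderiv (rshift _ j)).

(* [^*] would otherwise be [Num.conj] inside ring operations. *)
Local Notation "x ^*" := (conjc x) : ring_scope.

(** * Bihomogeneous polynomials and harmonic decomposition *)

Section bihomogeneous_polynomials.
Context {R : realType} {n : nat}.
Notation C := R[i].
Notation poly2 := (mpoly (n.+1 + n.+1) C).
Implicit Types (F G h : poly2) (j : 'I_n.+1).

Definition zv j : poly2 := mpolyX C (mnm1 (lshift n.+1 j)).
Definition zbv j : poly2 := mpolyX C (mnm1 (rshift n.+1 j)).
Definition euler_z F : poly2 := \sum_j zv j * dz j F.
Definition euler_zb F : poly2 := \sum_j zbv j * dzb j F.
(** A quarter of the Laplacian of R^(2n+2), written in the variables z and conj z; see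
    [laplacian_to_xy]. *)
Definition lapz F : poly2 := \sum_j dz j (dzb j F).
Definition sqnorm_poly : poly2 := \sum_j zv j * zbv j.

Lemma lapz_is_linear : linear lapz.
Proof.
move=> a F G; rewrite /lapz scaler_sumr -big_split; apply: eq_bigr => j _.
by rewrite !linearP.
Qed.
HB.instance Definition _ := GRing.isLinear.Build C poly2 poly2 *:%R lapz lapz_is_linear.

Lemma mderiv_var (i k : 'I_(n.+1 + n.+1)) :
  mderiv i (mpolyX C (mnm1 k)) = (i == k)%:R.
Proof.
rewrite mderivX mnm1E eq_sym; case: eqP => [->|_]; last by rewrite scale0r.
rewrite scale1r -mpolyX0; congr (mpolyX _ _); apply/mnmP => l.
by rewrite mnmBE mnm0E subnn.
Qed.

Lemma dz_zv i j : dz i (zv j) = (i == j)%:R.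
Proof. by rewrite mderiv_var (inj_eq (@lshift_inj _ _)). Qed.
Lemma dzb_zbv i j : dzb i (zbv j) = (i == j)%:R.
Proof. by rewrite mderiv_var (inj_eq (@rshift_inj _ _)). Qed.
Lemma dz_zbv i j : dz i (zbv j) = 0.
Proof. by rewrite mderiv_var eq_lrshift. Qed.
Lemma dzb_zv i j : dzb i (zv j) = 0.
Proof. by rewrite mderiv_var eq_rlshift. Qed.

Lemma dzM j F G : dz j (F * G) = dz j F * G + F * dz j G.
Proof. exact: mderivM. Qed.
Lemma dzbM j F G : dzb j (F * G) = dzb j F * G + F * dzb j G.
Proof. exact: mderivM. Qed.

Lemma dz_dzb i j F : dz i (dzb j F) = dzb j (dz i F).
Proof. exact: mderiv_comm. Qed.

Lemma sum_delta_mulr j (f : 'I_n.+1 -> poly2) : \sum_k (j == k)%:R * f k = f j.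
Proof.
rewrite (bigD1 j) //= eqxx mul1r big1 ?addr0 // => k /negPf kj.
by rewrite eq_sym kj mul0r.
Qed.

Lemma sum_delta_mull j (f : 'I_n.+1 -> poly2) : \sum_k f k * (j == k)%:R = f j.
Proof. by rewrite -[RHS]sum_delta_mulr; apply: eq_bigr => k _; rewrite mulrC. Qed.

Lemma dz_sqnorm j : dz j sqnorm_poly = zbv j.
Proof.
rewrite raddf_sum -[RHS]sum_delta_mulr /=; apply: eq_bigr => k _.
by rewrite dzM dz_zv dz_zbv mulr0 addr0.
Qed.
Lemma dzb_sqnorm j : dzb j sqnorm_poly = zv j.
Proof.
rewrite raddf_sum -[RHS]sum_delta_mull /=; apply: eq_bigr => k _.
by rewrite dzbM dzb_zv dzb_zbv mul0r add0r.
Qed.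

Lemma euler_zM F G : euler_z (F * G) = euler_z F * G + F * euler_z G.
Proof.
rewrite /euler_z mulr_suml mulr_sumr -big_split; apply: eq_bigr => j _ /=.
by rewrite dzM; ring.
Qed.
Lemma euler_zbM F G : euler_zb (F * G) = euler_zb F * G + F * euler_zb G.
Proof.
rewrite /euler_zb mulr_suml mulr_sumr -big_split; apply: eq_bigr => j _ /=.
by rewrite dzbM; ring.
Qed.

(** The commutator of a derivative with the Euler operator. It yields the degree of a derivative as
    q - 1 in C, so that q = 0 needs no separate case. *)
Lemma euler_zb_dzb j F : dzb j (euler_zb F) = dzb j F + euler_zb (dzb j F).
Proof.
rewrite /euler_zb raddf_sum -[X in _ = X + _](sum_delta_mulr j (fun k => dzb k F)) -big_split.
apply: eq_bigr => k _ /=; rewrite dzbM dzb_zbv; congr (_ + _ * _); exact: mderiv_comm.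
Qed.
Lemma euler_z_dz j F : dz j (euler_z F) = dz j F + euler_z (dz j F).
Proof.
rewrite /euler_z raddf_sum -[X in _ = X + _](sum_delta_mulr j (fun k => dz k F)) -big_split.
apply: eq_bigr => k _ /=; rewrite dzM dz_zv; congr (_ + _ * _); exact: mderiv_comm.
Qed.

Lemma lapz_sqnormM F :
  lapz (sqnorm_poly * F) =
  sqnorm_poly * lapz F + (euler_z F + euler_zb F + n.+1%:R * F).
Proof.
have -> : n.+1%:R * F = \sum_(j < n.+1) F :> poly2.
  by rewrite sumr_const card_ord mulr_natl.
rewrite /euler_z /euler_zb /lapz mulr_sumr -!big_split; apply: eq_bigr => j _ /=.
by rewrite dzbM dzb_sqnorm raddfD /= !dzM dz_zv dz_sqnorm eqxx mul1r; ring.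
Qed.

Lemma bihomogeneousP p q F : bihomogeneous p q F <->
  forall m, mcoeff m F != 0 -> (\sum_(j < n.+1) m (lshift n.+1 j) = p)%N /\
    (\sum_(j < n.+1) m (rshift n.+1 j) = q)%N.
Proof. by split=> H m; [rewrite -mcoeff_msupp|rewrite mcoeff_msupp]; exact: H. Qed.

Lemma bihomogeneous0 p q : bihomogeneous p q (0 : poly2).
Proof. by apply/bihomogeneousP => m; rewrite mcoeff0 eqxx. Qed.

Lemma bihomogeneousD p q F G :
  bihomogeneous p q F -> bihomogeneous p q G -> bihomogeneous p q (F + G).
Proof.
move=> hF hG m /msuppD_le; rewrite mem_cat => /orP[]; [exact: hF|exact: hG].
Qed.

Lemma bihomogeneousZ p q c F : bihomogeneous p q F -> bihomogeneous p q (c *: F).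
Proof. by move=> hF m /msuppZ_le; exact: hF. Qed.

Lemma bihomogeneousB p q F G :
  bihomogeneous p q F -> bihomogeneous p q G -> bihomogeneous p q (F - G).
Proof.
by move=> hF hG; rewrite -scaleN1r; apply/bihomogeneousD/bihomogeneousZ.
Qed.

Lemma bihomogeneous_sum p q (I : Type) (s : seq I) (P : pred I) (F : I -> poly2) :
  (forall i, P i -> bihomogeneous p q (F i)) ->
  bihomogeneous p q (\sum_(i <- s | P i) F i).
Proof.
move=> h; elim/big_ind: _ => //; [exact: bihomogeneous0|exact: bihomogeneousD].
Qed.

Lemma bihomogeneousM p q p' q' F G :
  bihomogeneous p q F -> bihomogeneous p' q' G ->
  bihomogeneous (p + p') (q + q') (F * G).
Proof.
move=> hF hG m /msuppM_le /allpairsP[[m1 m2] /= [/hF[<- <-] /hG[<- <-] ->]].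
by rewrite -!big_split; split; apply: eq_bigr => j _; rewrite mnmDE.
Qed.

Lemma bihomogeneousX (m : multinom (n.+1 + n.+1)) :
  bihomogeneous (\sum_(j < n.+1) m (lshift n.+1 j)) (\sum_(j < n.+1) m (rshift n.+1 j))
    (mpolyX C m).
Proof. by move=> m'; rewrite msuppX inE => /eqP ->. Qed.

Lemma sum_mnm1 (I : finType) (i : I) : (\sum_(j : I) (i == j) = 1)%N.
Proof.
by rewrite (bigD1 i) //= eqxx big1 // => j /negPf; rewrite eq_sym => ->.
Qed.

Lemma bihomogeneous_zv j : bihomogeneous 1 0 (zv j).
Proof.
move=> m; rewrite msuppX inE => /eqP ->; split.
  rewrite -[RHS](sum_mnm1 j); apply: eq_bigr => k _.
  by rewrite mnm1E (inj_eq (@lshift_inj _ _)).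
by rewrite big1 // => k _; rewrite mnm1E eq_lrshift.
Qed.
Lemma bihomogeneous_zbv j : bihomogeneous 0 1 (zbv j).
Proof.
move=> m; rewrite msuppX inE => /eqP ->; split.
  by rewrite big1 // => k _; rewrite mnm1E eq_rlshift.
rewrite -[RHS](sum_mnm1 j); apply: eq_bigr => k _.
by rewrite mnm1E (inj_eq (@rshift_inj _ _)).
Qed.

Lemma bihomogeneous_sqnorm : bihomogeneous 1 1 sqnorm_poly.
Proof.
apply: bihomogeneous_sum => j _.
have := bihomogeneousM (@bihomogeneous_zv j) (@bihomogeneous_zbv j).
by rewrite addn0 add0n.
Qed.

Lemma bihomogeneous_sqnormX (k : nat) : bihomogeneous k k (sqnorm_poly ^+ k).
Proof.
elim: k => [|k IH]; last first.
  by rewrite exprS -add1n; apply: bihomogeneousM => //; exact: bihomogeneous_sqnorm.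
move=> m; rewrite expr0 -mpolyC1 msuppC oner_eq0 inE => /eqP ->.
by split; rewrite big1 // => j _; rewrite mnm0E.
Qed.

Lemma mderiv_bihomogeneous_z p q j F :
  bihomogeneous p.+1 q F -> bihomogeneous p q (dz j F).
Proof.
move=> /bihomogeneousP h; apply/bihomogeneousP => m; rewrite mcoeff_mderiv => nz.
have /h[] : mcoeff (mnm_add m (mnm1 (lshift n.+1 j))) F != 0.
  by apply: contraNneq nz => ->; rewrite mul0rn.
under eq_bigr do rewrite mnmDE mnm1E (inj_eq (@lshift_inj _ _)).
under [X in _ -> X = _ -> _]eq_bigr do rewrite mnmDE mnm1E eq_lrshift addn0.
by rewrite big_split /= sum_mnm1 addn1 => -[<-] <-.
Qed.

Lemma mderiv_bihomogeneous_zb p q j F :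
  bihomogeneous p q.+1 F -> bihomogeneous p q (dzb j F).
Proof.
move=> /bihomogeneousP h; apply/bihomogeneousP => m; rewrite mcoeff_mderiv => nz.
have /h[] : mcoeff (mnm_add m (mnm1 (rshift n.+1 j))) F != 0.
  by apply: contraNneq nz => ->; rewrite mul0rn.
under eq_bigr do rewrite mnmDE mnm1E eq_rlshift addn0.
under [X in _ -> X = _ -> _]eq_bigr do rewrite mnmDE mnm1E (inj_eq (@rshift_inj _ _)).
by rewrite big_split /= sum_mnm1 addn1 => <- [<-].
Qed.

Lemma mderiv_bihomogeneous0 q j F : bihomogeneous 0 q F -> dz j F = 0.
Proof.
move=> /bihomogeneousP h; apply/mpolyP => m; rewrite mcoeff0 mcoeff_mderiv.
apply/eqP; rewrite mulrn_eq0 /=; apply/negP => /negP /h[+ _].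
under eq_bigr do rewrite mnmDE mnm1E (inj_eq (@lshift_inj _ _)).
by rewrite big_split /= sum_mnm1 addn1.
Qed.

Lemma mderiv_bihomogeneous0b p j F : bihomogeneous p 0 F -> dzb j F = 0.
Proof.
move=> /bihomogeneousP h; apply/mpolyP => m; rewrite mcoeff0 mcoeff_mderiv.
apply/eqP; rewrite mulrn_eq0 /=; apply/negP => /negP /h[_].
under eq_bigr do rewrite mnmDE mnm1E (inj_eq (@rshift_inj _ _)).
by rewrite big_split /= sum_mnm1 addn1.
Qed.

Lemma euler_monomial (i : 'I_(n.+1 + n.+1)) m :
  mpolyX C (mnm1 i) * mderiv i (mpolyX C m) = (m i)%:R * mpolyX C m.
Proof.
(* If [m i] is 0 the truncated exponent is wrong, but both sides have coefficient 0. *)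
rewrite mderivX -scalerAr -mpolyXD scaler_nat mulr_natl; case: (posnP (m i)) => [->//|mi].
congr (mpolyX _ _ *+ _); apply/mnmP => k; rewrite mnmDE mnmBE mnm1E subnKC //.
by case: eqP => // <-.
Qed.

Lemma euler_z_bihomogeneous p q F :
  bihomogeneous p q F -> euler_z F = p%:R * F.
Proof.
move=> h; rewrite {2}[F]mpolyE /euler_z.
under eq_bigr do rewrite {1}[F]mpolyE raddf_sum mulr_sumr.
rewrite exchange_big mulr_sumr; apply: eq_big_seq => m /h[<- _] /=.
under eq_bigr do rewrite /zv linearZ /= -scalerAr euler_monomial scalerAr.
by rewrite -mulr_suml natr_sum.
Qed.

Lemma euler_zb_bihomogeneous p q F :
  bihomogeneous p q F -> euler_zb F = q%:R * F.
Proof.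
move=> h; rewrite {2}[F]mpolyE /euler_zb.
under eq_bigr do rewrite {1}[F]mpolyE raddf_sum mulr_sumr.
rewrite exchange_big mulr_sumr; apply: eq_big_seq => m /h[_ <-] /=.
under eq_bigr do rewrite /zbv linearZ /= -scalerAr euler_monomial scalerAr.
by rewrite -mulr_suml natr_sum.
Qed.

Lemma lapz_bihomogeneous p q F :
  bihomogeneous p.+1 q.+1 F -> bihomogeneous p q (lapz F).
Proof.
move=> h; apply: bihomogeneous_sum => j _.
exact/mderiv_bihomogeneous_z/mderiv_bihomogeneous_zb.
Qed.

(** The constant is (k + 1)(p + q + n + 1 + k); its positivity is what allows division by it in the
    decomposition below. *)
Lemma lapz_sqnormX p q h (k : nat) : bihomogeneous p q h -> lapz h = 0 ->
  exists2 c, (0 < c)%N &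
    lapz (sqnorm_poly ^+ k.+1 * h) = c%:R * (sqnorm_poly ^+ k * h).
Proof.
move=> hpq h0; elim: k => [|k [c c0 IH]].
  exists (p + q + n.+1)%N; first by rewrite addnS.
  rewrite expr1 expr0 mul1r lapz_sqnormM h0 mulr0 add0r.
  rewrite (euler_z_bihomogeneous hpq) (euler_zb_bihomogeneous hpq) !natrD; ring.
have hk : bihomogeneous (k.+1 + p) (k.+1 + q) (sqnorm_poly ^+ k.+1 * h).
  exact/bihomogeneousM/hpq/bihomogeneous_sqnormX.
exists (c + (k.+1 + p) + (k.+1 + q) + n.+1)%N; first by rewrite !addn_gt0 c0.
rewrite {1}exprS -mulrA lapz_sqnormM IH (euler_z_bihomogeneous hk).
by rewrite (euler_zb_bihomogeneous hk) !natrD (exprS _ k); ring.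
Qed.

(* Fischer decomposition: since [lapz (|z|^(2k+2) h)] is a positive multiple of
   [|z|^(2k) h] for [h] harmonic, a decomposition of [lapz F] lifts to one of
   [F] up to a harmonic remainder. *)
Lemma harmonic_decomposition p q F : bihomogeneous p q F ->
  exists h : nat -> poly2,
    (forall k : nat, (k <= minn p q)%N ->
       bihomogeneous (p - k) (q - k) (h k) /\ lapz (h k) = 0) /\
    F = \sum_(k < (minn p q).+1) sqnorm_poly ^+ k * h k.
Proof.
(* If p or q is 0, the polynomial lacks one kind of variable and is already harmonic. *)
elim: p q F => [|p IH] [|q] F hF.
- exists (fun=> F); rewrite minnn big_ord_recl big_ord0 expr0 mul1r addr0; split=> // k.
  rewrite leqn0 => /eqP ->; split=> //; rewrite /lapz big1 // => j _.
  by rewrite (mderiv_bihomogeneous0b _ hF) raddf0.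
- exists (fun=> F); rewrite min0n big_ord_recl big_ord0 expr0 mul1r addr0; split=> // k.
  rewrite leqn0 => /eqP ->; split=> //; rewrite /lapz big1 // => j _.
  by rewrite dz_dzb (mderiv_bihomogeneous0 _ hF) raddf0.
- exists (fun=> F); rewrite minn0 big_ord_recl big_ord0 expr0 mul1r addr0; split=> // k.
  rewrite leqn0 => /eqP ->; split=> //; rewrite /lapz big1 // => j _.
  by rewrite (mderiv_bihomogeneous0b _ hF) raddf0.
have [h [hh lapF]] := IH q _ (lapz_bihomogeneous hF).
have /choice[c hc] : forall k : nat, exists c : nat, (k <= minn p q)%N ->
    (0 < c)%N /\
    lapz (sqnorm_poly ^+ k.+1 * h k) = c%:R * (sqnorm_poly ^+ k * h k).
  move=> k; case: (leqP k (minn p q)) => [kpq|_]; last by exists 0%N.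
  have [h1 h2] := hh k kpq.
  by have [c c0 e] := lapz_sqnormX k h1 h2; exists c.
pose h' k := ((c k)%:R : C)^-1 *: h k.
(* Q has the same [lapz] as F, so that F - Q is the harmonic term of index 0 and the [h'] take the
   indices from 1 on. *)
pose Q := \sum_(k < (minn p q).+1) sqnorm_poly ^+ k.+1 * h' k.
have hQ : lapz Q = lapz F.
  rewrite /Q lapF linear_sum; apply: eq_bigr => k _.
  have [|c0 e] := hc k; first by rewrite -ltnS.
  rewrite /h' -scalerAr linearZ /= e.
  rewrite (_ : (c k)%:R * _ = (c k)%:R *: (sqnorm_poly ^+ k * h k)); last first.
    by rewrite scaler_nat mulr_natl.
  rewrite scalerA.
  by rewrite mulVf ?scale1r // pnatr_eq0 -lt0n.
exists (fun k => if k is k'.+1 then h' k' else F - Q); split=> [[_|k]|].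
- rewrite !subn0; split; last by rewrite linearB /= hQ subrr.
  apply: bihomogeneousB => //; apply: bihomogeneous_sum => k _.
  have kpq : (k <= minn p q)%N by rewrite -ltnS.
  have := kpq; rewrite leq_min => /andP[kp kq].
  have -> : p.+1 = (k.+1 + (p - k))%N by rewrite addSn subnKC.
  have -> : q.+1 = (k.+1 + (q - k))%N by rewrite addSn subnKC.
  apply: bihomogeneousM; first exact: bihomogeneous_sqnormX.
  by apply: bihomogeneousZ; have [] := hh _ kpq.
- rewrite minnSS ltnS => /hh[h1 h2]; rewrite !subSS; split; last by rewrite linearZ /= h2 scaler0.
  exact: bihomogeneousZ.
by rewrite minnSS big_ord_recl expr0 mul1r -/Q subrK.
Qed.

End bihomogeneous_polynomials.

(** * Invariant functionals on polynomials *)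

Section invariant_functional.
Context {R : realType} {n : nat}.
Notation C := R[i].
Notation poly2 := (mpoly (n.+1 + n.+1) C).
Implicit Types (F G h : poly2) (j : 'I_n.+1).
(* The restriction of an invariant integral on the sphere to polynomials: the
   last hypothesis is invariance under the infinitesimal unitary group. *)
Variable L : {linear poly2 -> C^o}.
Hypothesis L_sqnorm : forall F, L (sqnorm_poly * F) = L F.
Hypothesis L_rotation : forall k j F, L (zv k * dz j F - zbv j * dzb k F) = 0.

(** Insert |z|^2 on the left and sum over k the rotation identity for conj(z_k) F. The n + 1 counts
    the derivatives of conj z_k by itself; with the Euler operator in place of a degree, F may be
    any polynomial. *)
Lemma functional_dz j F :
  L (dz j F) = L (zbv j * (n.+1%:R * F + euler_zb F)).
Proof.
apply/eqP; rewrite -subr_eq0 -L_sqnorm -linearB /=; apply/eqP.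
transitivity (L (\sum_k (zv k * dz j (zbv k * F) - zbv j * dzb k (zbv k * F)))).
  congr (L _); rewrite sumrB; congr (_ - _).
    rewrite mulr_suml; apply: eq_bigr => k _.
    by rewrite mderivM dz_zbv; ring.
  rewrite -mulr_sumr; congr (_ * _).
  under eq_bigr do rewrite mderivM dzb_zbv eqxx mul1r.
  by rewrite big_split /= sumr_const card_ord mulr_natl.
by rewrite linear_sum big1 // => k _; rewrite L_rotation.
Qed.

Lemma functional_dzb j F :
  L (dzb j F) = L (zv j * (n.+1%:R * F + euler_z F)).
Proof.
apply/eqP; rewrite eq_sym -subr_eq0 -[X in _ - X]L_sqnorm -linearB /=; apply/eqP.
transitivity (L (\sum_k (zv j * dz k (zv k * F) - zbv k * dzb j (zv k * F)))).
  congr (L _); rewrite sumrB; congr (_ - _).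
    rewrite -mulr_sumr; congr (_ * _).
    under eq_bigr do rewrite mderivM dz_zv eqxx mul1r.
    by rewrite big_split /= sumr_const card_ord mulr_natl.
  rewrite mulr_suml; apply: eq_bigr => k _.
  by rewrite mderivM dzb_zv; ring.
by rewrite linear_sum big1 // => k _; rewrite L_rotation.
Qed.

(** The diagonal rotations add up to the generator of z -> exp(it) z, which multiplies F by p - q up
    to a factor i. *)
Lemma functional_unbalanced p q F : bihomogeneous p q F -> p != q -> L F = 0.
Proof.
move=> hF pq; have : L ((p%:R - q%:R) *: F) = 0.
  rewrite scalerBl -!mul_mpolyC !rmorph_nat -(euler_z_bihomogeneous hF).
  rewrite -(euler_zb_bihomogeneous hF) /euler_z /euler_zb -sumrB linear_sum big1 //.
  by move=> j _; rewrite L_rotation.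
rewrite linearZ /= => /eqP; rewrite mulf_eq0 subr_eq0 eqr_nat (negPf pq) /=.
by move/eqP.
Qed.

(* Green's formula: the integrals of [sum_j dz j (F * dzb j G)] and of
   [sum_j dzb j (G * dz j F)] agree for harmonic [F] and [G]. *)
Lemma functional_orthogonal p q p' q' F G :
  bihomogeneous p q F -> bihomogeneous p' q' G -> L (F * lapz G) = 0 ->
  L (G * lapz F) = 0 -> (p', q') != (q, p) -> L (F * G) = 0.
Proof.
move=> hF hG FG0 GF0 ne.
have [bal|] := eqVneq (p + p')%N (q + q')%N; last first.
  exact/functional_unbalanced/bihomogeneousM/hG.
have pq' : q' != p.
  apply: contraNneq ne => e; move: bal; rewrite e addnC => /addIn ->.
  by rewrite eqxx.
have e1 : \sum_j L (dz j (F * dzb j G)) =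
    \sum_j L (dz j F * dzb j G).
  under eq_bigr do rewrite mderivM linearD.
  by rewrite big_split /= -[X in _ + X]linear_sum -mulr_sumr FG0 addr0.
have e2 : \sum_j L (dzb j (G * dz j F)) = \sum_j L (dz j F * dzb j G).
  under eq_bigr do rewrite mderivM linearD mulrC.
  rewrite big_split /= -[X in _ + X]linear_sum -mulr_sumr.
  suff -> : \sum_(i < n.+1) dzb i (dz i F) = lapz F by rewrite GF0 addr0.
  by apply: eq_bigr => j _; rewrite dz_dzb.
have natL (m : nat) X : L (m%:R * X) = m%:R * L X.
  by rewrite mulr_natl linearMn /= mulr_natl.
(* [F * dzb j G] has degree q + q' - 1 in conj z, which turns the n + 1 of [functional_dz] into n +
   q + q'. *)
have d1 : \sum_j L (dz j (F * dzb j G)) = (n%:R + q%:R + q'%:R) * q'%:R * L (F * G).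
  transitivity (L ((n%:R + q%:R + q'%:R) * F * euler_zb G)).
    rewrite /euler_zb mulr_sumr linear_sum; apply: eq_bigr => j _.
    rewrite functional_dz euler_zbM (euler_zb_bihomogeneous hF); congr (L _).
    have -> : euler_zb (dzb j G) = (q'%:R - 1) * dzb j G.
      have := euler_zb_dzb j G; rewrite (euler_zb_bihomogeneous hG).
      rewrite mulr_natl linearMn /= -(mulr_natl (dzb j G)) => e.
      by rewrite mulrBl mul1r e addrAC subrr add0r.
    by rewrite -natr1; ring.
  rewrite (euler_zb_bihomogeneous hG) -!natrD -natrM -natL.
  by congr (L _); rewrite natrM; ring.
have d2 : \sum_j L (dzb j (G * dz j F)) = (n%:R + p%:R + p'%:R) * p%:R * L (F * G).
  transitivity (L ((n%:R + p%:R + p'%:R) * G * euler_z F)).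
    rewrite /euler_z mulr_sumr linear_sum; apply: eq_bigr => j _.
    rewrite functional_dzb euler_zM (euler_z_bihomogeneous hG); congr (L _).
    have -> : euler_z (dz j F) = (p%:R - 1) * dz j F.
      have := euler_z_dz j F; rewrite (euler_z_bihomogeneous hF).
      rewrite mulr_natl linearMn /= -(mulr_natl (dz j F)) => e.
      by rewrite mulrBl mul1r e addrAC subrr add0r.
    by rewrite -natr1; ring.
  rewrite (euler_z_bihomogeneous hF) -!natrD -natrM -natL.
  by congr (L _); rewrite natrM; ring.
(* Since p + p' = q + q', the first factors of [d1] and [d2] agree. *)
have : (n%:R + q%:R + q'%:R) * (q'%:R - p%:R) * L (F * G) = 0.
  apply/eqP; rewrite mulrBr mulrBl subr_eq0 -d1 e1 -e2 d2; apply/eqP.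
  by rewrite -!natrD -!addnA bal.
move/eqP; rewrite !mulf_eq0 subr_eq0 eqr_nat (negPf pq') orbF -!natrD pnatr_eq0.
(* If n + q + q' = 0, then q = q' = 0 and the balance forces p = 0 = q', which [pq'] excludes. *)
case: eqP => [z|_ /eqP//].
move: bal pq' z; case: (p) => [|m]; case: (q') => [|m'] //; rewrite ?addnS //.
by move=> e _ /eqP; rewrite -addnA !addn_eq0 => /andP[_ /andP[/eqP q0 _]]; move: e; rewrite q0.
Qed.

(* The annihilator is stable under derivatives by [functional_dz] and
   [functional_dzb]; differentiating down to a constant shows it is trivial. *)
Lemma functional_nondegenerate p q F : L 1 != 0 ->
  bihomogeneous p q F -> (forall G, L (F * G) = 0) -> F = 0.
Proof.
move=> L1; have [N] := ubnP (p + q)%N; elim: N => // N IH in p q F *.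
rewrite ltnS => pqN hF F0.
have dF j : dz j F = 0.
  case: p hF pqN => [|p] hF pqN; first exact: mderiv_bihomogeneous0 hF.
  apply: (IH _ _ _ _ (mderiv_bihomogeneous_z hF)) => // G.
  (* [functional_dz] rewrites the integral of the first term as F against another polynomial, so
     both terms vanish. *)
  have -> : dz j F * G = dz j (F * G) - F * dz j G by rewrite mderivM addrK.
  rewrite linearB /= F0 subr0 functional_dz euler_zbM (euler_zb_bihomogeneous hF).
  rewrite -[RHS](F0 (zbv j * ((n.+1%:R + q%:R) * G + euler_zb G))).
  by congr (L _); ring.
have dbF j : dzb j F = 0.
  case: q hF pqN => [|q] hF pqN; first exact: mderiv_bihomogeneous0b hF.
  apply: (IH _ _ _ _ (mderiv_bihomogeneous_zb hF)) => [|G]; first by rewrite -addnS.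
  have -> : dzb j F * G = dzb j (F * G) - F * dzb j G by rewrite mderivM addrK.
  rewrite linearB /= F0 subr0 functional_dzb euler_zM (euler_z_bihomogeneous hF).
  rewrite -[RHS](F0 (zv j * ((n.+1%:R + p%:R) * G + euler_z G))).
  by congr (L _); ring.
(* By Euler's identity: all first derivatives vanish, so F = 0 unless its bidegree is (0, 0). *)
have : ((p + q)%:R : C) *: F = 0.
  rewrite scaler_nat -mulr_natl natrD mulrDl -(euler_z_bihomogeneous hF).
  rewrite -(euler_zb_bihomogeneous hF) /euler_z /euler_zb.
  by rewrite !big1 ?addr0 // => j _; rewrite ?dF ?dbF mulr0.
move/eqP; rewrite scaler_eq0 pnatr_eq0 addn_eq0 => /orP[pq0|/eqP//].
have [p0 q0] : p = 0%N /\ q = 0%N by case/andP: pq0 => /eqP -> /eqP ->.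
move: hF; rewrite p0 q0 => hF.
have FC : F = mpolyC _ (mcoeff mnm0 F).
  apply/mpolyP => m; rewrite mcoeffC.
  have [->|m0] := eqVneq m mnm0; first by rewrite mulr1.
  rewrite mulr0; apply/eqP; apply: contraNT m0 => Fm.
  have [/eqP zl /eqP zr] := (bihomogeneousP 0 0 F).1 hF m Fm.
  apply/eqP/mnmP => i; rewrite mnm0E -(splitK i).
  move: zl zr; rewrite !sum_nat_eq0 => /forallP zl /forallP zr.
  by case: (fintype.split i) => k /=; apply/eqP; [exact: zl|exact: zr].
move: (F0 1); rewrite mulr1 FC -[mpolyC _ _]mulr1 mul_mpolyC linearZ /= => /eqP.
by rewrite mulf_eq0 (negPf L1) orbF => /eqP ->; rewrite scale0r.
Qed.

End invariant_functional.

(** * Integration of complex-valued functions *)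

Section complex_valued_functions.
Context {R : realType}.
Notation C := R[i].

Lemma complexReD (x y : C) : complex.Re (x + y) = complex.Re x + complex.Re y.
Proof. by case: x y => [? ?] []. Qed.
Lemma complexImD (x y : C) : complex.Im (x + y) = complex.Im x + complex.Im y.
Proof. by case: x y => [? ?] []. Qed.
Lemma complexReM (x y : C) :
  complex.Re (x * y) = complex.Re x * complex.Re y - complex.Im x * complex.Im y.
Proof. by case: x y => [? ?] []. Qed.
Lemma complexImM (x y : C) :
  complex.Im (x * y) = complex.Re x * complex.Im y + complex.Im x * complex.Re y.
Proof. by case: x y => [? ?] []. Qed.

Lemma complexRe_sum (I : Type) (s : seq I) (P : pred I) (f : I -> C) :
  complex.Re (\sum_(i <- s | P i) f i) = \sum_(i <- s | P i) complex.Re (f i).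
Proof. by apply: (big_morph (@complex.Re R)) => // x y; exact: complexReD. Qed.
Lemma complexIm_sum (I : Type) (s : seq I) (P : pred I) (f : I -> C) :
  complex.Im (\sum_(i <- s | P i) f i) = \sum_(i <- s | P i) complex.Im (f i).
Proof. by apply: (big_morph (@complex.Im R)) => // x y; exact: complexImD. Qed.

Lemma conjcD (x y : C) : (x + y)^* = x^* + y^*.
Proof. exact: raddfD. Qed.
Lemma conjcB (x y : C) : (x - y)^* = x^* - y^*.
Proof. exact: raddfB. Qed.
Lemma conjcM (x y : C) : (x * y)^* = x^* * y^*.
Proof. exact: rmorphM. Qed.
Lemma conjc_sum (I : Type) (s : seq I) (P : pred I) (f : I -> C) :
  (\sum_(i <- s | P i) f i)^* = \sum_(i <- s | P i) (f i)^*.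
Proof. exact: rmorph_sum. Qed.

Lemma norm_normc (x : C) : `|x| = (Normc.normc x)%:C.
Proof. by case: x. Qed.

Lemma normr_Re_le (x : C) : `|complex.Re x| <= Normc.normc x.
Proof. by rewrite -lecR -norm_normc normc_ge_Re. Qed.
Lemma normr_Im_le (x : C) : `|complex.Im x| <= Normc.normc x.
Proof.
have := normr_Re_le (x * 'i); rewrite Normc.normcM complexReM /= mulr0 mulr1 sub0r normrN.
by rewrite expr0n expr1n add0r sqrtr1 mulr1.
Qed.
Lemma normc_le_Re_Im (x : C) : Normc.normc x <= `|complex.Re x| + `|complex.Im x|.
Proof.
case: x => a b /=; rewrite -[leRHS]ger0_norm ?addr_ge0 // -sqrtr_sqr ler_sqrt ?sqr_ge0 //.
by rewrite sqrrD !real_normK ?num_real // addrAC lerDl mulrn_wge0 ?mulr_ge0.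
Qed.

Lemma continuous_Re : continuous (@complex.Re R : C -> R).
Proof.
move=> x A /nbhs_ballP[e e0 eA]; apply/(nbhs_ballP x); exists e%:C => /=.
  by rewrite ltcR.
move=> y; rewrite -ball_normE /= norm_normc ltcR => xy; apply: eA => /=.
rewrite -ball_normE /=; apply: le_lt_trans xy.
by case: x y => [a b] [c d]; exact: (normr_Re_le (_ +i* _)).
Qed.
Lemma continuous_Im : continuous (@complex.Im R : C -> R).
Proof.
move=> x A /nbhs_ballP[e e0 eA]; apply/(nbhs_ballP x); exists e%:C => /=.
  by rewrite ltcR.
move=> y; rewrite -ball_normE /= norm_normc ltcR => xy; apply: eA => /=.
rewrite -ball_normE /=; apply: le_lt_trans xy.
by case: x y => [a b] [c d]; exact: (normr_Im_le (_ +i* _)).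
Qed.

Lemma continuous_conjc : continuous (@conjc R : C -> C).
Proof.
move=> x A /(nbhs_ballP (conjc x))[e e0 eA]; apply/(nbhs_ballP x); exists e => //.
move=> y; rewrite -ball_normE /= => xy; apply: eA => /=.
by rewrite -ball_normE /= -raddfB normcJ.
Qed.

Section measurable.
Context d (T : measurableType d).
Implicit Types f g : T -> C.

Definition cmeasurable f :=
  measurable_fun [set: T] (fun x => complex.Re (f x)) /\
  measurable_fun [set: T] (fun x => complex.Im (f x)).

Lemma cmeasurable_cst c : cmeasurable (fun=> c).
Proof. by split; exact: measurable_cst. Qed.

Lemma cmeasurableD f g : cmeasurable f -> cmeasurable g ->
  cmeasurable (fun x => f x + g x).
Proof.
move=> [f1 f2] [g1 g2]; split.
  by under eq_fun do rewrite complexReD; exact: measurable_funD.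
by under eq_fun do rewrite complexImD; exact: measurable_funD.
Qed.

Lemma cmeasurableM f g : cmeasurable f -> cmeasurable g ->
  cmeasurable (fun x => f x * g x).
Proof.
move=> [f1 f2] [g1 g2]; split.
  by under eq_fun do rewrite complexReM; apply: measurable_funB; exact: measurable_funM.
by under eq_fun do rewrite complexImM; apply: measurable_funD; exact: measurable_funM.
Qed.

Lemma measurable_normc f : cmeasurable f ->
  measurable_fun [set: T] (fun x => Normc.normc (f x)).
Proof.
move=> [f1 f2].
rewrite (_ : (fun x => _) = fun x => Num.sqrt (complex.Re (f x) ^+ 2 + complex.Im (f x) ^+ 2)).
  apply: measurableT_comp; last by apply: measurable_funD; exact: measurable_funX.
  apply: continuous_measurable_fun; exact: sqrt_continuous.
by apply/funext => x; case: (f x).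
Qed.

Variable mu : {measure set T -> \bar R}.

Definition cintegrable f :=
  mu.-integrable [set: T] (fun x => (complex.Re (f x))%:E) /\
  mu.-integrable [set: T] (fun x => (complex.Im (f x))%:E).

Lemma cintegralD f g : cintegrable f -> cintegrable g ->
  cintegral mu (fun x => f x + g x) = cintegral mu f + cintegral mu g.
Proof.
move=> [f1 f2] [g1 g2]; rewrite /cintegral.
under eq_Rintegral do rewrite complexReD.
under [in X in _ +i* X = _]eq_Rintegral do rewrite complexImD.
by rewrite !RintegralD.
Qed.

Lemma cintegralZ c f : cintegrable f ->
  cintegral mu (fun x => c * f x) = c * cintegral mu f.
Proof.
move=> [f1 f2]; rewrite /cintegral.
under eq_Rintegral do rewrite complexReM.
under [in X in _ +i* X = _]eq_Rintegral do rewrite complexImM.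
have iZ (a : R) (u : T -> R) : mu.-integrable [set: T] (EFin \o u) ->
    mu.-integrable [set: T] (EFin \o (fun x => a * u x)).
  move=> iu; rewrite (_ : EFin \o _ = (fun x => a%:E * (u x)%:E)%E) //.
  exact: (integrableZl measurableT).
rewrite RintegralB ?RintegralD ?RintegralZl //; try exact: iZ.
by case: c.
Qed.

Lemma cintegrable_norm f : cmeasurable f ->
  mu.-integrable [set: T] (fun x => (Normc.normc (f x))%:E) -> cintegrable f.
Proof.
move=> [f1 f2] fi; split; apply: le_integrable fi => //.
- exact/measurable_EFinP.
- move=> x _ /=; rewrite lee_fin [leRHS]ger0_norm ?normr_Re_le //.
  exact: le_trans (normr_ge0 _) (normr_Re_le _).
- exact/measurable_EFinP.
- move=> x _ /=; rewrite lee_fin [leRHS]ger0_norm ?normr_Im_le //.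
  exact: le_trans (normr_ge0 _) (normr_Re_le _).
Qed.

End measurable.

Section bounded.
Context d (T : measurableType d) (mu : probability T R).
Implicit Types f g : T -> C.

(** A class stable under products, unlike integrability, which contains all polynomials on the
    sphere and is integrable for every probability. *)
Definition bounded_cmeasurable f :=
  cmeasurable f /\ exists M : R, forall x, Normc.normc (f x) <= M.

Lemma bounded_cmeasurable_cst c : bounded_cmeasurable (fun=> c).
Proof. by split; [exact: cmeasurable_cst|exists (Normc.normc c)]. Qed.

Lemma bounded_cmeasurableD f g : bounded_cmeasurable f -> bounded_cmeasurable g ->
  bounded_cmeasurable (fun x => f x + g x).
Proof.
move=> [f1 [M fM]] [g1 [N gN]]; split; first exact: cmeasurableD.
exists (M + N) => x; apply: le_trans (lerD (fM x) (gN x)).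
by rewrite -lecR rmorphD /= -!norm_normc ler_normD.
Qed.

Lemma bounded_cmeasurableM f g : bounded_cmeasurable f -> bounded_cmeasurable g ->
  bounded_cmeasurable (fun x => f x * g x).
Proof.
move=> [f1 [M fM]] [g1 [N gN]]; split; first exact: cmeasurableM.
have n0 (x : C) : 0 <= Normc.normc x.
  exact: le_trans (normr_ge0 _) (normr_Re_le _).
by exists (M * N) => x; rewrite Normc.normcM ler_pM.
Qed.

Lemma bounded_cintegrable f : bounded_cmeasurable f -> cintegrable mu f.
Proof.
move=> [mf [M fM]]; apply: cintegrable_norm => //.
apply: (@measurable_bounded_integrable _ _ _ mu (fun x => Normc.normc (f x))) => //.
- by rewrite (le_lt_trans (probability_le1 _ _)) ?ltry.
- exact: measurable_normc.
exists M; split; first exact: num_real.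
move=> r Mr x _ /=; rewrite ger0_norm.
  by apply: le_trans (fM x) _; exact: ltW.
exact: le_trans (normr_ge0 _) (normr_Re_le _).
Qed.

(** The factor 2 comes from bounding the real and imaginary parts separately; the estimates below
    absorb it. *)
Lemma normc_cintegral_le f (M : R) : bounded_cmeasurable f ->
  (forall x, Normc.normc (f x) <= M) ->
  Normc.normc (cintegral mu f) <= M *+ 2.
Proof.
move=> bf fM; have [if1 if2] := bounded_cintegrable bf.
have bound u : mu.-integrable [set: T] (EFin \o u) ->
    (forall x, `|u x| <= M) -> `|\int[mu]_x u x| <= M.
  move=> iu uM; apply: le_trans (le_normr_Rintegral _ iu) _ => //.
  have -> : M = \int[mu]_x (cst M) x.
    by rewrite Rintegral_cst // [X in fine X](@probability_setT _ _ _ mu) mulr1.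
  apply: le_Rintegral => //; first exact: integrable_norm.
  exact: finite_measure_integrable_cst.
apply: le_trans (normc_le_Re_Im _) _; rewrite /= mulr2n lerD //; apply: bound => // x.
  exact: le_trans (normr_Re_le _) (fM x).
exact: le_trans (normr_Im_le _) (fM x).
Qed.

End bounded.
End complex_valued_functions.

(** * Polynomials and unitary maps on the sphere *)

(** Induction along the ring operations, suited to properties that pass through sums and products,
    such as continuity, bounds or Leibniz rules. *)
Lemma mpoly_ring_ind (K : comNzRingType) m (P : mpoly m K -> Prop) :
  (forall c, P (mpolyC m c)) -> (forall F G, P F -> P G -> P (F + G)) ->
  (forall F G, P F -> P G -> P (F * G)) -> (forall i, P (mpolyX K (mnm1 i))) ->
  forall F, P F.
Proof.
move=> PC PD PM PX F; elim/mpolyind: F => [|c m' F _ _ PF]; first by rewrite -mpolyC0.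
apply: PD => //; rewrite -mul_mpolyC; apply: (PM) => //; rewrite mpolyXE_id.
elim/big_ind: _ => [||i _]; [by rewrite -mpolyC1|exact: PM|].
elim: (m' i) => [|k IH]; first by rewrite expr0 -mpolyC1.
by rewrite exprS; exact: PM.
Qed.

Section sphere_polynomials.
Context {R : realType} {n : nat}.
Notation C := R[i].
Notation S := (sphere R n).
Notation poly2 := (mpoly (n.+1 + n.+1) C).
Implicit Types (F G : poly2).

Lemma continuous_complexD (T : topologicalType) (f g : T -> C) :
  continuous f -> continuous g -> continuous (fun x => f x + g x).
Proof. by move=> cf cg x; exact: (@cvgD C C^o _ (nbhs x) _ f g _ _ (cf x) (cg x)). Qed.

Lemma continuous_complexM (T : topologicalType) (f g : T -> C) :
  continuous f -> continuous g -> continuous (fun x => f x * g x).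
Proof. by move=> cf cg x; exact: (@cvgM C _ (nbhs x) _ f g _ _ (cf x) (cg x)). Qed.

Lemma continuous_zcoord j : continuous (fun z : S => zcoord z j).
Proof.
move=> z; apply: (@continuous_comp S _ _ (set_val : S -> 'rV[C]_n.+1) (fun M => M ord0 j)).
  exact: initial_continuous.
exact: coord_continuous.
Qed.

Lemma eval_sphereC c : eval_sphere (mpolyC _ c) = (fun=> c) :> (S -> C).
Proof. by apply/funext => z; exact: mevalC. Qed.
Lemma eval_sphereD F G :
  eval_sphere (F + G) = (fun z => eval_sphere F z + eval_sphere G z) :> (S -> C).
Proof. by apply/funext => z; exact: mevalD. Qed.
Lemma eval_sphereB F G :
  eval_sphere (F - G) = (fun z => eval_sphere F z - eval_sphere G z) :> (S -> C).
Proof. by apply/funext => z; exact: mevalB. Qed.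
Lemma eval_sphereM F G :
  eval_sphere (F * G) = (fun z => eval_sphere F z * eval_sphere G z) :> (S -> C).
Proof. by apply/funext => z; exact: mevalM. Qed.
Lemma eval_sphereZ c F :
  eval_sphere (c *: F) = (fun z => c * eval_sphere F z) :> (S -> C).
Proof. by apply/funext => z; exact: mevalZ. Qed.
Lemma eval_sphere_zv j : eval_sphere (zv j) = (fun z => zcoord z j) :> (S -> C).
Proof.
by apply/funext => z; rewrite /eval_sphere mevalXU -[lshift _ j]/(unsplit (inl j)) unsplitK.
Qed.
Lemma eval_sphere_zbv j : eval_sphere (zbv j) = (fun z => (zcoord z j)^*) :> (S -> C).
Proof.
by apply/funext => z; rewrite /eval_sphere mevalXU -[rshift _ j]/(unsplit (inr j)) unsplitK.
Qed.
Lemma eval_sphere_sum (I : Type) (s : seq I) (P : pred I) (F : I -> poly2) :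
  eval_sphere (\sum_(i <- s | P i) F i) =
  \sum_(i <- s | P i) (eval_sphere (F i) : S -> C).
Proof.
apply/funext => z; rewrite /eval_sphere raddf_sum.
by elim/big_ind2 : _ => // x y x' y' -> ->.
Qed.

Lemma eval_sphere_sqnorm (z : S) : eval_sphere sqnorm_poly z = 1.
Proof.
have /set_mem <- := valP z.
rewrite eval_sphere_sum fct_sumE; apply: eq_bigr => j _.
by rewrite eval_sphereM eval_sphere_zv eval_sphere_zbv sqr_normc.
Qed.

Lemma zcoord_norm_le1 (z : S) j : `|zcoord z j| <= 1.
Proof.
rewrite -(@expr_le1 _ 2) //.
have /set_mem <- := valP z.
rewrite (bigD1 j) //= lerDl sumr_ge0 // => k _; exact: exprn_ge0.
Qed.

Lemma continuous_eval_sphere F : continuous (eval_sphere F : S -> C).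
Proof.
elim/mpoly_ring_ind: F => [c|F G hF hG|F G hF hG|i].
- by rewrite eval_sphereC => x; exact: (@cst_continuous S C c x).
- by rewrite eval_sphereD; exact: (continuous_complexD hF hG).
- by rewrite eval_sphereM; exact: (continuous_complexM hF hG).
rewrite -(splitK i); case: (fintype.split i) => j.
  rewrite -[mpolyX _ _]/(zv j) eval_sphere_zv; exact: continuous_zcoord.
rewrite -[mpolyX _ _]/(zbv j) eval_sphere_zbv => z.
apply: (@continuous_comp S _ _ (fun z => zcoord z j) (@conjc R)).
  exact: continuous_zcoord.
exact: continuous_conjc.
Qed.

Lemma continuous_measurable_sphere (f : S -> R) :
  continuous f -> measurable_fun [set: S] f.
Proof.
move=> /continuousP cf; apply: (measurability _ (RGenOpens.measurableE R)).
move=> _ [_ [a [b ->] <-]]; rewrite setTI; apply: sub_sigma_algebra.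
exact/cf/interval_open.
Qed.

Lemma continuous_cmeasurable (f : S -> C) : continuous f -> cmeasurable f.
Proof.
move=> cf; split; apply: continuous_measurable_sphere => x.
  by apply: (continuous_comp (cf x)); exact: continuous_Re.
by apply: (continuous_comp (cf x)); exact: continuous_Im.
Qed.

Lemma bounded_eval_sphere F : exists M : R, forall z : S,
  Normc.normc (eval_sphere F z) <= M.
Proof.
elim/mpoly_ring_ind: F => [c|F G [M hM] [N hN]|F G [M hM] [N hN]|i].
- by exists (Normc.normc c); rewrite eval_sphereC.
- exists (M + N) => z; rewrite eval_sphereD; apply: le_trans (lerD (hM z) (hN z)).
  by rewrite -lecR rmorphD /= -!norm_normc ler_normD.
- exists (M * N) => z; rewrite eval_sphereM Normc.normcM ler_pM //;
    exact: le_trans (normr_ge0 _) (normr_Re_le _).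
exists 1 => z; rewrite -lecR -norm_normc -(splitK i); case: (fintype.split i) => j.
  rewrite -[mpolyX _ _]/(zv j) eval_sphere_zv; exact: zcoord_norm_le1.
rewrite -[mpolyX _ _]/(zbv j) eval_sphere_zbv normcJ; exact: zcoord_norm_le1.
Qed.

Lemma bounded_cmeasurable_eval_sphere F :
  bounded_cmeasurable (eval_sphere F : S -> C).
Proof.
by split; [exact/continuous_cmeasurable/continuous_eval_sphere|exact: bounded_eval_sphere].
Qed.

Section unitary.
Variable U : 'M[C]_n.+1.
Hypothesis unitaryU : U *m (map_mx (@conjc R) U)^T = 1%:M.

Lemma unitary_sphere (z : S) : sphere_set R n ((set_val z : 'rV_n.+1) *m U).
Proof.
have E (v : 'rV[C]_n.+1) :
    \sum_j `|v ord0 j| ^+ 2 = (v *m (map_mx (@conjc R) v)^T) ord0 ord0.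
  by rewrite mxE; apply: eq_bigr => j _; rewrite !mxE sqr_normc.
rewrite /sphere_set /= E map_mxM trmx_mul mulmxA -(mulmxA _ U) unitaryU mulmx1 -E.
exact: set_mem (valP z).
Qed.

Definition unitary_map (z : S) : S :=
  SigSub (mem_set (unitary_sphere z)) : set_type (sphere_set R n).

Lemma zcoord_unitary_map (z : S) j :
  zcoord (unitary_map z) j = \sum_k zcoord z k * U k j.
Proof. by rewrite /zcoord /= mxE. Qed.

Lemma continuous_unitary_map : continuous unitary_map.
Proof.
apply: (@continuous_comp_initial _ S _ set_val unitary_map) => z A [P hP sPA].
(* A neighbourhood of a matrix contains a box of neighbourhoods of its entries, and each entry of
   the image is a polynomial in z. *)
have : \forall z' \near z, forall ij : 'I_1 * 'I_n.+1,
    P ij.1 ij.2 ((set_val (unitary_map z') : 'rV_n.+1) ij.1 ij.2).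
  apply: (@filter_forall S _ _ (nbhs z) (nbhs_filter z)) => -[i j] /=.
  have ct : continuous (fun z' : S => zcoord (unitary_map z') j).
    rewrite (_ : (fun z' => _) = eval_sphere (\sum_k U k j *: zv k)).
      exact: continuous_eval_sphere.
    apply/funext => z'; rewrite zcoord_unitary_map eval_sphere_sum fct_sumE.
    by apply: eq_bigr => k _; rewrite eval_sphereZ eval_sphere_zv mulrC.
  rewrite (ord1 i); exact: (ct z _ (hP ord0 j)).
by apply: (@filterS S (nbhs z) (nbhs_filter z)) => z' h; apply: sPA => i j; exact: (h (i, j)).
Qed.

Lemma measurable_unitary_map : measurable_fun [set: S] unitary_map.
Proof.
apply: (@measurability _ _ S S setT unitary_map (@open S) (erefl _)).
move=> _ [B oB <-]; rewrite setTI; apply: sub_sigma_algebra.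
by move/continuousP: continuous_unitary_map; apply.
Qed.

Variable sigma : probability S R.
Hypothesis hsigma : rotation_invariant sigma.

(** On rows (x, y) with z = x + iy, right multiplication by U = Ur + i Ui is the real block matrix
    below, and its orthogonality is the real and imaginary parts of the unitarity of U. *)
Lemma unitary_invariant (B : set S) : measurable B ->
  sigma (unitary_map @^-1` B) = sigma B.
Proof.
pose Ur := map_mx (@complex.Re R) U; pose Ui := map_mx (@complex.Im R) U.
have eU i j : \sum_k U i k * (U j k)^* = (i == j)%:R.
  by have /matrixP/(_ i j) := unitaryU; rewrite !mxE => <-; apply: eq_bigr => k _; rewrite !mxE.
have Re0 (b : bool) : complex.Re (b%:R : C) = b%:R by case: b.
have Im0 (b : bool) : complex.Im (b%:R : C) = 0 by case: b.
apply: (hsigma (A := block_mx Ur Ui (- Ui) Ur)).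
  rewrite tr_block_mx mulmx_block [RHS]scalar_mx_block; congr block_mx.
  - apply/matrixP => i j; rewrite !mxE -[RHS](Re0 (i == j)) -eU complexRe_sum -big_split; apply: eq_bigr => k _ /=.
    by rewrite !mxE complexReM; case: (U j k) => a b /=; ring.
  - apply/matrixP => i j; rewrite !mxE -[RHS](Im0 (i == j)) -eU complexIm_sum -big_split.
    apply: eq_bigr => k _ /=.
    by rewrite !mxE complexImM; case: (U j k) => a b /=; ring.
  - apply/matrixP => i j; rewrite !mxE -[RHS](Im0 (j == i)) -eU complexIm_sum -big_split.
    apply: eq_bigr => k _ /=.
    by rewrite !mxE complexImM; case: (U i k) => a b /=; ring.
  apply/matrixP => i j; rewrite !mxE -[RHS](Re0 (i == j)) -eU complexRe_sum -big_split; apply: eq_bigr => k _ /=.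
  by rewrite !mxE complexReM; case: (U j k) => a b /=; ring.
move=> z; rewrite /real_coords mul_row_block; congr row_mx.
  apply/rowP => j; rewrite !mxE zcoord_unitary_map complexRe_sum -big_split; apply: eq_bigr => k _ /=.
  by rewrite !mxE complexReM mulrN.
apply/rowP => j; rewrite !mxE zcoord_unitary_map complexIm_sum -big_split; apply: eq_bigr => k _ /=.
by rewrite !mxE complexImM.
Qed.

Lemma cintegral_unitary (f : S -> C) : bounded_cmeasurable f ->
  cintegral sigma (fun z => f (unitary_map z)) = cintegral sigma f.
Proof.
move=> [[f1 f2] [M fM]].
have inv (u : S -> R) : measurable_fun [set: S] u ->
    (forall x, `|u x| <= M) -> \int[sigma]_x u (unitary_map x) = \int[sigma]_x u x.
  move=> mu uM; congr fine.
  transitivity (\int[pushforward sigma unitary_map]_x (u x)%:E)%E.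
    rewrite integral_pushforward //; first exact: measurable_unitary_map.
      exact/measurable_EFinP.
    rewrite preimage_setT.
    apply: (@measurable_bounded_integrable _ _ _ sigma (fun x => u (unitary_map x))) => //.
    - by rewrite (le_lt_trans (probability_le1 _ _)) ?ltry.
    - exact: (measurableT_comp mu measurable_unitary_map).
    exists M; split; first exact: num_real.
    by move=> r Mr x _ /=; apply: le_trans (uM _) _; exact: ltW.
  apply: eq_measure_integral; first exact: measurable_unitary_map.
  by move=> mphi B mB _; rewrite /= /pushforward unitary_invariant.
rewrite /cintegral; congr Complex; apply: inv => // x.
  exact: le_trans (normr_Re_le _) (fM x).
exact: le_trans (normr_Im_le _) (fM x).
Qed.

End unitary.
End sphere_polynomials.

(** * Infinitesimal rotations *)

(** Stands for the limit as t tends to 0; the factor 2 is the one of [normc_cintegral_le]. *)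
Lemma le_linear_eq0 (K : realFieldType) (a k : K) : 0 <= a -> 0 <= k ->
  (forall t, 0 < t -> t <= 1 -> a <= k * t *+ 2) -> a = 0.
Proof.
move=> a0 k0 h; apply/eqP; rewrite eq_le a0 andbT leNgt; apply/negP => {}a0.
have d0 : 0 < a + k *+ 2 + 1 by rewrite mulr2n; lra.
(* This t is at most 1 and satisfies 2kt < a. *)
have := h (a / (a + k *+ 2 + 1)); rewrite divr_gt0 // ler_pdivrMr // mul1r.
have -> : a <= a + k *+ 2 + 1 by rewrite mulr2n; lra.
move=> /(_ isT isT); rewrite -mulrnAl mulrA ler_pdivlMr // mulr2n; nra.
Qed.

(** Here a is a value at a moved point, a0 the value at the base point and a1 the derivative, and
    likewise for b. *)
Lemma first_order_add (K : numDomainType) (a a0 a1 b b0 b1 t : K) :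
  `|a + b - (a0 + b0) - t * (a1 + b1)| <= `|a - a0 - t * a1| + `|b - b0 - t * b1|.
Proof.
apply: le_trans (ler_normD _ _).
have -> : a - a0 - t * a1 + (b - b0 - t * b1) = a + b - (a0 + b0) - t * (a1 + b1).
  by ring.
exact: lexx.
Qed.

(** The Leibniz rule for expansions with a quadratic remainder: the error is that of a times b, plus
    the expansion of a times the error of b, plus the cross term t^2 a1 b1. *)
Lemma first_order_mul (K : numDomainType) (a a0 a1 b b0 b1 t M M1 N N1 A B : K) :
  0 <= t -> t <= 1 -> `|a0| <= M -> `|a1| <= M1 -> `|b| <= N -> `|b1| <= N1 ->
  `|a - a0 - t * a1| <= A * t ^+ 2 -> `|b - b0 - t * b1| <= B * t ^+ 2 ->
  `|a * b - a0 * b0 - t * (a1 * b0 + a0 * b1)| <=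
    (A * N + (M + M1) * B + M1 * N1) * t ^+ 2.
Proof.
move=> t0 t1 ha0 ha1 hb hb1 hA hB.
have -> : a * b - a0 * b0 - t * (a1 * b0 + a0 * b1) =
  (a - a0 - t * a1) * b + (a0 + t * a1) * (b - b0 - t * b1) + t ^+ 2 * (a1 * b1).
  by ring.
have -> : (A * N + (M + M1) * B + M1 * N1) * t ^+ 2 =
  A * t ^+ 2 * N + (M + M1) * (B * t ^+ 2) + t ^+ 2 * (M1 * N1) by ring.
apply: le_trans (ler_normD _ _) _; rewrite lerD //; last first.
  by rewrite normrM normrX normrM (ger0_norm t0) ler_wpM2l ?exprn_ge0 ?ler_pM.
apply: le_trans (ler_normD _ _) _; rewrite !normrM lerD // ler_pM //.
apply: le_trans (ler_normD _ _) _; rewrite lerD // normrM (ger0_norm t0).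
by rewrite -[leRHS]mul1r ler_pM.
Qed.

Section infinitesimal_rotations.
Context {R : realType} {n : nat}.
Notation C := R[i].
Notation S := (sphere R n).
Notation poly2 := (mpoly (n.+1 + n.+1) C).
Implicit Types (F G : poly2).

Lemma bounded_eval_sphereC F : exists2 M : C, 0 <= M &
  forall z : S, `|eval_sphere F z| <= M.
Proof.
have [M hM] := bounded_eval_sphere F; exists `|M|%:C; first by rewrite ler0c.
by move=> z; rewrite norm_normc lecR; apply: le_trans (hM z) (ler_norm M).
Qed.

Section generator.
Variable v : 'I_n.+1 -> C.

(* The derivative at [w = 1] along the unit circle of the unitary maps
   [z |-> z + (w - 1) (z . conj v) v], for a unit vector [v]. *)
Definition rotation_generator F : poly2 :=
  'i%C *: \sum_k \sum_l ((v k)^* * v l) *: (zv k * dz l F - zbv l * dzb k F).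

Lemma rotation_generatorC c : rotation_generator (mpolyC _ c) = 0.
Proof.
rewrite /rotation_generator big1 ?scaler0 // => k _; rewrite big1 // => l _.
by rewrite !mderivC !mulr0 subr0 scaler0.
Qed.

Lemma rotation_generatorD F G :
  rotation_generator (F + G) = rotation_generator F + rotation_generator G.
Proof.
rewrite /rotation_generator -scalerDr -big_split; congr (_ *: _); apply: eq_bigr => k _ /=.
rewrite -big_split; apply: eq_bigr => l _ /=.
by rewrite -scalerDr !mderivD; congr (_ *: _); ring.
Qed.

Lemma rotation_generatorM F G :
  rotation_generator (F * G) = rotation_generator F * G + F * rotation_generator G.
Proof.
rewrite /rotation_generator -scalerAl -scalerAr -scalerDr; congr (_ *: _).
rewrite mulr_suml mulr_sumr -big_split; apply: eq_bigr => k _ /=.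
rewrite mulr_suml mulr_sumr -big_split; apply: eq_bigr => l _ /=.
by rewrite -scalerAl -scalerAr -scalerDr !mderivM; congr (_ *: _); ring.
Qed.

Lemma rotation_generator_zv j :
  rotation_generator (zv j) = ('i%C * v j) *: \sum_k (v k)^* *: zv k.
Proof.
rewrite /rotation_generator -scalerA; congr (_ *: _); rewrite scaler_sumr.
apply: eq_bigr => k _; rewrite (bigD1 j) //= big1 ?addr0 => [|l /negPf lj].
  by rewrite dz_zv dzb_zv eqxx mulr1 mulr0 subr0 scalerA mulrC.
by rewrite dz_zv dzb_zv lj !mulr0 subr0 scaler0.
Qed.

Lemma rotation_generator_zbv j :
  rotation_generator (zbv j) = - ('i%C * (v j)^*) *: \sum_k v k *: zbv k.
Proof.
rewrite /rotation_generator -mulrN -scalerA scaleNr -scalerN; congr (_ *: _).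
rewrite (bigD1 j) //= [X in _ + X]big1 ?addr0 => [|k /negPf kj]; last first.
  by rewrite big1 // => l _; rewrite dz_zbv dzb_zbv kj !mulr0 subr0 scaler0.
rewrite -sumrN scaler_sumr; apply: eq_bigr => l _.
by rewrite dz_zbv dzb_zbv eqxx mulr1 mulr0 sub0r !scalerN scalerA.
Qed.

(** The generator is a derivation, so sums and products follow from the two lemmas on first-order
    expansions, and only the coordinates require a computation. Assuming merely that w is 1 + it up
    to t^2 makes the exponential dispensable; K is uniform in z, t and w. *)
Lemma rotation_estimate F : exists2 K : C, 0 <= K &
  forall (t w : C) (z z' : S), 0 <= t -> t <= 1 -> `|w - 1 - 'i%C * t| <= t ^+ 2 ->
    (forall l, zcoord z' l =
       zcoord z l + (w - 1) * (\sum_k zcoord z k * (v k)^*) * v l) ->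
    `|eval_sphere F z' - eval_sphere F z - t * eval_sphere (rotation_generator F) z|
      <= K * t ^+ 2.
Proof.
have sum_le (z : S) : `|\sum_k zcoord z k * (v k)^*| <= \sum_k `|v k|.
  apply: le_trans (ler_norm_sum _ _ _) _; apply: ler_sum => k _.
  by rewrite normrM normcJ ler_piMl // zcoord_norm_le1.
have sum0 : 0 <= \sum_k `|v k| by rewrite sumr_ge0.
elim/mpoly_ring_ind: F => [c|F G [K K0 hF] [K' K'0 hG]|F G [K K0 hF] [K' K'0 hG]|i].
- exists 0 => // t w z z' _ _ _ _.
  rewrite rotation_generatorC -mpolyC0 !eval_sphereC.
  by rewrite subrr mulr0 subr0 normr0 mul0r.
- exists (K + K'); first exact: addr_ge0.
  move=> t w z z' t0 t1 hw hz; rewrite rotation_generatorD !eval_sphereD mulrDl.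
  apply: le_trans (lerD (hF _ _ _ _ t0 t1 hw hz) (hG _ _ _ _ t0 t1 hw hz)).
  exact: first_order_add.
- have [M M0 hM] := bounded_eval_sphereC F.
  have [M1 M10 hM1] := bounded_eval_sphereC (rotation_generator F).
  have [N N0 hN] := bounded_eval_sphereC G.
  have [N1 N10 hN1] := bounded_eval_sphereC (rotation_generator G).
  exists (K * N + (M + M1) * K' + M1 * N1).
    by rewrite !addr_ge0 ?mulr_ge0 ?addr_ge0.
  move=> t w z z' t0 t1 hw hz; rewrite rotation_generatorM eval_sphereD !eval_sphereM.
  exact: (first_order_mul t0 t1 (hM z) (hM1 z) (hN z') (hN1 z)
    (hF _ _ _ _ t0 t1 hw hz) (hG _ _ _ _ t0 t1 hw hz)).
(* One factor bounds z . conj v on the sphere, the other bounds |v_j|. *)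
exists ((\sum_k `|v k|) * (\sum_k `|v k|)); first exact: mulr_ge0.
move=> t w z z' t0 t1 hw hz; rewrite -(splitK i); case: (fintype.split i) => j.
  rewrite -[mpolyX _ _]/(zv j) rotation_generator_zv eval_sphereZ eval_sphere_zv.
  rewrite eval_sphere_sum fct_sumE hz.
  under [X in t * (_ * X)]eq_bigr do rewrite eval_sphereZ eval_sphere_zv mulrC.
  (* Coordinates are affine in w, so their error is exactly proportional to w - 1 - it. *)
  rewrite (_ : _ - _ - _ = (w - 1 - 'i%C * t) * (\sum_k zcoord z k * (v k)^*) * v j); last by ring.
  rewrite !normrM mulrC mulrCA mulrC; apply: ler_pM; rewrite ?mulr_ge0 //.
  rewrite mulrC ler_pM // (bigD1 j) //= lerDl sumr_ge0 //.
rewrite -[mpolyX _ _]/(zbv j) rotation_generator_zbv eval_sphereZ eval_sphere_zbv.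
rewrite eval_sphere_sum fct_sumE hz.
under [X in t * (_ * X)]eq_bigr do rewrite eval_sphereZ eval_sphere_zbv mulrC.
rewrite (_ : _ - _ - _ = ((w - 1 - 'i%C * t) * (\sum_k zcoord z k * (v k)^*) * v j)^*).
  rewrite normcJ !normrM mulrC mulrCA mulrC; apply: ler_pM; rewrite ?mulr_ge0 //.
  rewrite mulrC ler_pM // (bigD1 j) //= lerDl sumr_ge0 //.
have tr : t^* = t by rewrite -(RRe_real (ger0_real t0)) conjc_real.
have ir : ('i%C)^* = - 'i%C :> C by apply/eqP; rewrite eq_complex /= oppr0 !eqxx.
rewrite conjcD !conjcM !conjcB conjc1 conjcM tr ir !conjc_sum.
rewrite (_ : \sum_k (zcoord z k * (v k)^*)^* = \sum_k (zcoord z k)^* * v k).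
  by ring.
by apply: eq_bigr => k _; rewrite conjcM conjcK.
Qed.

Hypothesis unit_v : \sum_k `|v k| ^+ 2 = 1.

(** U multiplies the component along v by w and fixes its orthogonal complement. The terms beyond
    the identity add up to a multiple of (w - 1) + (conj w - 1) + (w - 1)(conj w - 1) = |w|^2 - 1 =
    0. *)
Lemma rank_one_unitary (w : C) : `|w| = 1 ->
  let U := \matrix_(k, l) ((k == l)%:R + (w - 1) * ((v k)^* * v l)) in
  U *m (map_mx (@conjc R) U)^T = 1%:M.
Proof.
move=> w1 /=; apply/matrixP => i j; rewrite !mxE.
have ww : w * w^* = 1 by rewrite -sqr_normc w1 expr1n.
have vv : \sum_k v k * (v k)^* = 1.
  by rewrite -unit_v; apply: eq_bigr => k _; rewrite sqr_normc.
under eq_bigr do rewrite !mxE.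
transitivity (\sum_k ((i == k)%:R * (j == k)%:R +
   (i == k)%:R * ((w^* - 1) * (v j * (v k)^*)) + (j == k)%:R * ((w - 1) * ((v i)^* * v k)) +
   (w - 1) * (w^* - 1) * ((v i)^* * v j) * (v k * (v k)^*))).
  apply: eq_bigr => k _; rewrite conjcD !conjcM conjcB conjc1 conjcK.
  by rewrite conjc_nat; ring.
have delta_sum (l : 'I_n.+1) (f : 'I_n.+1 -> C) : \sum_k (l == k)%:R * f k = f l.
  rewrite (bigD1 l) //= eqxx mul1r big1 ?addr0 // => k /negPf kl.
  by rewrite eq_sym kl mul0r.
rewrite !big_split /= -mulr_sumr vv !delta_sum [j == i]eq_sym.
rewrite (_ : (w - 1) * (w^* - 1) = 1 + w * w^* - w - w^*); last by ring.
by rewrite ww; ring.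
Qed.

Variable sigma : probability S R.
Hypothesis hsigma : rotation_invariant sigma.

(** By invariance, F(g z) - F(z) - t X F(z), with X the generator, integrates to -t I, while
    [rotation_estimate] bounds it by k t^2. Hence |I| is at most 2kt for every t in (0, 1]. *)
Lemma cintegral_rotation_generator F :
  cintegral sigma (eval_sphere (rotation_generator F)) = 0.
Proof.
have [K K0 hK] := rotation_estimate F.
have KR : K = (complex.Re K)%:C by rewrite RRe_real // ger0_real.
set k := complex.Re K in KR; have k0 : 0 <= k by rewrite -ler0c -KR.
set I := cintegral _ _; pose A : R := Normc.normc I.
have key (t : R) : 0 < t -> t <= 1 -> A <= k * t *+ 2.
  (* The point w = s + it of the unit circle replaces exp(it): |w - 1 - it| = 1 - s, at most 1 - s^2
     = t^2. *)
  move=> t0 t1; pose s := Num.sqrt (1 - t ^+ 2).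
  have s0 : 0 <= s by rewrite sqrtr_ge0.
  have ss : s ^+ 2 = 1 - t ^+ 2 by rewrite sqr_sqrtr // subr_ge0 expr_le1 // ltW.
  pose w : C := s +i* t.
  have w1 : `|w| = 1 by rewrite norm_normc /= ss subrK sqrtr1.
  have hw : `|w - 1 - 'i%C * t%:C| <= t%:C ^+ 2.
    rewrite (_ : w - 1 - 'i%C * t%:C = (s - 1)%:C); last first.
      by apply/eqP; rewrite eq_complex /=; apply/andP; split; apply/eqP; ring.
    rewrite -rmorphXn /= norm_normc lecR /= expr0n addr0 sqrtr_sqr ler_norml.
    by apply/andP; split; nra.
  have bF := bounded_cmeasurable_eval_sphere F.
  have bX := bounded_cmeasurable_eval_sphere (rotation_generator F).
  pose g := unitary_map (rank_one_unitary w1).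
  have bFg : bounded_cmeasurable (fun z => eval_sphere F (g z)).
    have [_ [M hM]] := bF; split; last by exists M => z; exact: hM.
    apply: continuous_cmeasurable => z; apply: continuous_comp.
      exact: continuous_unitary_map.
    exact: continuous_eval_sphere.
  pose f z := eval_sphere F (g z) + ((-1) * eval_sphere F z +
    (- t%:C) * eval_sphere (rotation_generator F) z).
  have b1 : bounded_cmeasurable (fun z : S => (-1) * eval_sphere F z).
    exact: bounded_cmeasurableM (bounded_cmeasurable_cst _ _) bF.
  have b2 : bounded_cmeasurable
      (fun z : S => (- t%:C) * eval_sphere (rotation_generator F) z).
    exact: bounded_cmeasurableM (bounded_cmeasurable_cst _ _) bX.
  have bf : bounded_cmeasurable f by apply/bounded_cmeasurableD/bounded_cmeasurableD.
  have If : cintegral sigma f = - (t%:C * I).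
    rewrite /f cintegralD; try exact: bounded_cintegrable; last first.
      exact/bounded_cintegrable/bounded_cmeasurableD.
    rewrite cintegralD; try exact: bounded_cintegrable.
    rewrite !cintegralZ; try exact: bounded_cintegrable.
    by rewrite /g (cintegral_unitary _ hsigma) // mulN1r addrA subrr add0r mulNr.
  have fb z : Normc.normc (f z) <= k * t ^+ 2.
    rewrite -lecR -norm_normc rmorphM rmorphXn /= -KR.
    rewrite /f mulN1r mulNr addrA; apply: (hK _ w) => //; first by rewrite ler0c ltW.
      by rewrite lecR.
    move=> l; rewrite /g zcoord_unitary_map.
    under eq_bigr do rewrite mxE mulrDr.
    rewrite big_split /= (bigD1 l) //= eqxx mulr1 big1 ?addr0 => [|m /negPf ->]; last by rewrite mulr0.
    by congr (_ + _); rewrite mulr_sumr mulr_suml; apply: eq_bigr => m _; ring.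
  have := normc_cintegral_le sigma bf fb.
  rewrite If -mulNr Normc.normcM (_ : Normc.normc (- t%:C) = t).
    rewrite -/A -[A <= _](ler_pM2l t0) (_ : t * (k * t *+ 2) = k * t ^+ 2 *+ 2) //.
    by rewrite !mulr2n; ring.
  by rewrite /= oppr0 expr0n addr0 sqrtr_sqr normrN gtr0_norm.
apply: Normc.eq0_normc; apply: (le_linear_eq0 _ k0 key).
exact: le_trans (normr_ge0 _) (normr_Re_le _).
Qed.

End generator.
End infinitesimal_rotations.

(** * The invariant integral on polynomials *)

Section laplacian_in_complex_coordinates.
Context {R : realType} {n : nat}.
Notation C := R[i].
Notation S := (sphere R n).
Notation poly2 := (mpoly (n.+1 + n.+1) C).
Implicit Types (F G P : poly2).

Lemma to_xyC c : to_xy (mpolyC _ c) = mpolyC _ c :> poly2.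
Proof. exact: comp_mpolyC. Qed.
Lemma to_xyD F G : to_xy (F + G) = to_xy F + to_xy G.
Proof. exact: comp_mpolyD. Qed.
Lemma to_xyM F G : to_xy (F * G) = to_xy F * to_xy G.
Proof. exact: (rmorphM (comp_mpoly _)). Qed.
Lemma to_xyZ c F : to_xy (c *: F) = c *: to_xy F.
Proof. exact: comp_mpolyZ. Qed.
Lemma to_xy_var (i : 'I_(n.+1 + n.+1)) :
  to_xy (mpolyX C (mnm1 i)) = z_in_xy R i.
Proof. by rewrite /to_xy comp_mpolyXU -tnth_nth tnth_mktuple. Qed.

Lemma z_in_xy_zv j : to_xy (zv j : poly2) = zv j + 'i%C *: zbv j.
Proof.
by rewrite /zv to_xy_var /z_in_xy -[lshift _ j]/(unsplit (inl j)) unsplitK.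
Qed.
Lemma z_in_xy_zbv j : to_xy (zbv j : poly2) = zv j - 'i%C *: zbv j.
Proof.
by rewrite /zbv to_xy_var /z_in_xy -[rshift _ j]/(unsplit (inr j)) unsplitK.
Qed.

(** An algebraic chain rule: both sides are derivations along the ring morphism [phi], so they agree
    once they agree on the variables. *)
Lemma derivation_comp (phi d : poly2 -> poly2) (i : 'I_(n.+1 + n.+1)) :
  (forall c, phi (mpolyC _ c) = mpolyC _ c) -> {morph phi : F G / F + G} ->
  {morph phi : F G / F * G} -> (forall c, d (mpolyC _ c) = 0) ->
  {morph d : F G / F + G} -> (forall F G, d (F * G) = d F * G + F * d G) ->
  (forall k, mderiv i (phi (mpolyX C (mnm1 k))) = phi (d (mpolyX C (mnm1 k)))) ->
  forall P, mderiv i (phi P) = phi (d P).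
Proof.
move=> phiC phiD phiM dC dD dM dX; elim/mpoly_ring_ind => [c|F G hF hG|F G hF hG|//].
- by rewrite phiC mderivC dC -mpolyC0 phiC.
- by rewrite phiD mderivD hF hG dD phiD.
by rewrite phiM mderivM hF hG dM phiD !phiM.
Qed.

(** After [to_xy] the two blocks of variables stand for x and y, so the left-hand [dz j] is d/dx_j,
    and [dzb j] in the next lemma is d/dy_j. *)
Lemma dx_to_xy j P : dz j (to_xy P) = to_xy (dz j P + dzb j P).
Proof.
apply: (@derivation_comp (@to_xy R n) (fun P => dz j P + dzb j P) _
  to_xyC to_xyD to_xyM) => [c|F G|F G|i].
- by rewrite !mderivC addr0.
- by rewrite !mderivD addrACA.
- by rewrite !mderivM mulrDl mulrDr addrACA.
rewrite -(splitK i); case: (fintype.split i) => k.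
  rewrite -[mpolyX _ _]/(zv k) z_in_xy_zv mderivD mderivZ !(dz_zv, dz_zbv, dzb_zv).
  by rewrite scaler0 !addr0; case: (j == k); rewrite -?mpolyC0 -?mpolyC1 to_xyC.
rewrite -[mpolyX _ _]/(zbv k) z_in_xy_zbv mderivB mderivZ !(dz_zv, dz_zbv, dzb_zbv).
by rewrite scaler0 subr0 add0r; case: (j == k); rewrite -?mpolyC0 -?mpolyC1 to_xyC.
Qed.

Lemma dy_to_xy j P : dzb j (to_xy P) = to_xy ('i%C *: (dz j P - dzb j P)).
Proof.
apply: (@derivation_comp (@to_xy R n) (fun P => 'i%C *: (dz j P - dzb j P)) _
  to_xyC to_xyD to_xyM) => [c|F G|F G|i].
- by rewrite !mderivC subr0 scaler0.
- by rewrite !mderivD -scalerDr addrACA opprD.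
- by rewrite !mderivM -scalerAl -scalerAr -scalerDr mulrBl mulrBr addrACA -opprD.
rewrite -(splitK i); case: (fintype.split i) => k.
  rewrite -[mpolyX _ _]/(zv k) z_in_xy_zv mderivD mderivZ !(dz_zv, dzb_zbv, dzb_zv).
  rewrite subr0 add0r to_xyZ; congr (_ *: _).
  by case: (j == k); rewrite -?mpolyC0 -?mpolyC1 to_xyC.
rewrite -[mpolyX _ _]/(zbv k) z_in_xy_zbv mderivB mderivZ !(dzb_zv, dz_zbv, dzb_zbv).
rewrite sub0r sub0r to_xyZ -scalerN; congr (_ *: _).
by case: (j == k); rewrite -?mpolyC0 -?mpolyC1 -mpolyCN to_xyC.
Qed.

(** For each j, (d + db)^2 - (d - db)^2 = 4 d db. *)
Lemma laplacian_to_xy P : laplacian (to_xy P) = 4%:R *: to_xy (lapz P).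
Proof.
rewrite /laplacian big_split_ord /= -big_split /= -to_xyZ.
transitivity (\sum_j to_xy (4%:R *: dz j (dzb j P))); last first.
  by rewrite /lapz scaler_sumr /to_xy raddf_sum.
apply: eq_bigr => j _.
rewrite !(dx_to_xy, dy_to_xy) -to_xyD; congr to_xy.
rewrite !mderivZ !mderivB !mderivD -scalerBr scalerA.
have -> : 'i%C * 'i%C = -1 :> C by rewrite -expr2 sqr_i.
rewrite scaleN1r (dz_dzb j j) scaler_nat -mulr_natl; ring.
Qed.

Definition xy_point (z : S) (k : 'I_(n.+1 + n.+1)) : C :=
  match fintype.split k with
  | inl j => (complex.Re (zcoord z j))%:C
  | inr j => (complex.Im (zcoord z j))%:C
  end.

Lemma meval_to_xy (z : S) P : meval (xy_point z) (to_xy P) = eval_sphere P z.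
Proof.
rewrite /to_xy comp_mpoly_meval; apply: meval_eq => k; rewrite tnth_mktuple /z_in_xy.
have vl j : meval (xy_point z) (mpolyX C (mnm1 (lshift n.+1 j))) =
    (complex.Re (zcoord z j))%:C.
  by rewrite mevalXU /xy_point -[lshift _ j]/(unsplit (inl j)) unsplitK.
have vr j : meval (xy_point z) (mpolyX C (mnm1 (rshift n.+1 j))) =
    (complex.Im (zcoord z j))%:C.
  by rewrite mevalXU /xy_point -[rshift _ j]/(unsplit (inr j)) unsplitK.
case: (fintype.split k) => j.
  by rewrite mevalD mevalZ vl vr -complexE.
rewrite mevalB mevalZ vl vr; case: (zcoord z j) => a b.
by apply/eqP; rewrite eq_complex /=; apply/andP; split; apply/eqP; ring.
Qed.

Lemma harmonic_lapz P : lapz P = 0 -> laplacian (to_xy P) = 0.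
Proof. by move=> P0; rewrite laplacian_to_xy P0 -mpolyC0 to_xyC mpolyC0 scaler0. Qed.

(** Values on the sphere are enough under an integral, and obtaining them by evaluation spares the
    injectivity of [to_xy]. *)
Lemma lapz_harmonic P (z : S) : laplacian (to_xy P) = 0 -> eval_sphere (lapz P) z = 0.
Proof.
rewrite laplacian_to_xy => /eqP; rewrite scaler_eq0 pnatr_eq0 /= => /eqP P0.
by rewrite -meval_to_xy P0 meval0.
Qed.

End laplacian_in_complex_coordinates.

(* Polarization along rational unit vectors avoids square roots. *)
Lemma hermitian_polarization (R : realType) n (B : 'I_n.+1 -> 'I_n.+1 -> R[i]) :
  (forall v : 'I_n.+1 -> R[i], \sum_k `|v k| ^+ 2 = 1 ->
     \sum_k \sum_l ((v k)^* * v l) * B k l = 0) ->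
  forall k j, B k j = 0.
Proof.
move=> h k j.
have delta (l : 'I_n.+1) (f : 'I_n.+1 -> R[i]) : \sum_m (m == l)%:R * f m = f l.
  rewrite (bigD1 l) //= eqxx mul1r big1 ?addr0 // => m /negPf ->.
  by rewrite mul0r.
have diag l : B l l = 0.
  have := h (fun m => (m == l)%:R).
  have -> : \sum_m `|(m == l)%:R : R[i]| ^+ 2 = 1.
    rewrite -[RHS](delta l (fun=> 1)); apply: eq_bigr => m _.
    by case: (m == l); rewrite ?normr1 ?normr0 ?expr1n ?expr0n ?mul1r ?mul0r.
  move=> /(_ erefl) <-; rewrite -[LHS](delta l (fun k => B k l)).
  apply: eq_bigr => m _; rewrite -[in LHS](delta l (B m)) mulr_sumr.
  by apply: eq_bigr => m' _; rewrite conjc_nat mulrA.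
have [->|kj] := eqVneq k j; first exact: diag.
have mixed (u : R[i]) : u * u^* = 1 -> u * B k j + u^* * B j k = 0.
  (* The unit vector has entries 3/5 at k and 4u/5 at j; as the diagonal of B vanishes, only the
     cross terms remain, with factor 12/25. The existentials keep a and b opaque. *)
  move=> uu; have [a aE] : exists a : R[i], a = 3%:R / 5%:R by eexists.
  have [b bE] : exists b : R[i], b = 4%:R / 5%:R * u by eexists.
  pose v m : R[i] := (m == k)%:R * a + (m == j)%:R * b.
  have ca : a^* = a by rewrite aE conjcM conjc_inv !conjc_nat.
  have cb : b^* = 4%:R / 5%:R * u^* by rewrite bE !conjcM conjc_inv !conjc_nat.
  have five : 5%:R != 0 :> R[i] by rewrite pnatr_eq0.
  have sumv (f : 'I_n.+1 -> R[i]) : \sum_m v m * f m = a * f k + b * f j.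
    rewrite -[f k in RHS](delta k) -[f j in RHS](delta j) !mulr_sumr -big_split.
    by apply: eq_bigr => m _; rewrite /v /=; ring.
  have sumcv (f : 'I_n.+1 -> R[i]) : \sum_m (v m)^* * f m = a * f k + b^* * f j.
    rewrite -[f k in RHS](delta k) -[f j in RHS](delta j) !mulr_sumr -big_split.
    by apply: eq_bigr => m _; rewrite /v conjcD !conjcM !conjc_nat ca /=; ring.
  have nv : \sum_m `|v m| ^+ 2 = 1.
    under eq_bigr do rewrite sqr_normc.
    rewrite sumv /v !eqxx (negPf kj) eq_sym (negPf kj) !mul1r !mul0r addr0 add0r.
    rewrite ca cb aE bE.
    transitivity ((9%:R + 16%:R * (u * u^*)) / 25%:R : R[i]).
      by field; rewrite ?pnatr_eq0.
    by rewrite uu; field; rewrite ?pnatr_eq0.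
  have := h v nv.
  under eq_bigr do under eq_bigr do rewrite -mulrA.
  under eq_bigr do rewrite -mulr_sumr sumv.
  rewrite sumcv !diag cb aE bE => /eqP.
  rewrite (_ : _ + _ = 12%:R / 25%:R * (u * B k j + u^* * B j k)); last first.
    by field; rewrite ?pnatr_eq0.
  by rewrite mulf_eq0 => /orP[|/eqP //]; rewrite mulf_eq0 invr_eq0 !pnatr_eq0.
(* u = 1 gives the sum of [B k j] and [B j k], and u = i gives their difference. *)
have := mixed 1; rewrite conjc1 !mul1r => /(_ erefl) m1.
have ii : 'i%C * 'i%C = -1 :> R[i] by rewrite -expr2 sqr_i.
have ci : ('i%C)^* = - 'i%C :> R[i] by apply/eqP; rewrite eq_complex /= oppr0 !eqxx.
have := mixed 'i%C; rewrite ci mulrN ii opprK => /(_ erefl) mi.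
have : 'i%C * ('i%C * B k j + - 'i%C * B j k) = 0 by rewrite mi mulr0.
rewrite mulrDr mulNr mulrN !mulrA ii => m2.
have : 2%:R * B k j = 0.
  transitivity (B k j + B j k - (-1 * B k j - -1 * B j k)); first by ring.
  by rewrite m1 m2 subr0.
by move/eqP; rewrite mulf_eq0 pnatr_eq0 => /eqP.
Qed.

Section invariant_integral.
Context {R : realType} {n : nat}.
Notation C := R[i].
Notation S := (sphere R n).
Notation poly2 := (mpoly (n.+1 + n.+1) C).
Implicit Types (F G P : poly2).
Variable sigma : probability S R.

Definition sphere_functional F : C^o := cintegral sigma (eval_sphere F).

Lemma cintegrable_eval_sphere F : cintegrable sigma (eval_sphere F : S -> C).
Proof. exact/bounded_cintegrable/bounded_cmeasurable_eval_sphere. Qed.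

Lemma sphere_functional_linear : linear sphere_functional.
Proof.
move=> c F G; rewrite /sphere_functional eval_sphereD cintegralD; last first.
- exact: cintegrable_eval_sphere.
- exact: cintegrable_eval_sphere.
by rewrite eval_sphereZ cintegralZ //; exact: cintegrable_eval_sphere.
Qed.

HB.instance Definition _ :=
  GRing.isLinear.Build C poly2 C^o *:%R sphere_functional sphere_functional_linear.

Lemma sphere_functional1 : sphere_functional 1 != 0.
Proof.
rewrite /sphere_functional -mpolyC1 eval_sphereC /cintegral /=.
rewrite !Rintegral_cst //.
rewrite [X in fine X](@probability_setT _ _ _ sigma) mulr1 mul0r.
exact: oner_neq0.
Qed.

Lemma sphere_functional_ext F G : (forall z : S, eval_sphere F z = eval_sphere G z) ->
  sphere_functional F = sphere_functional G.
Proof. by move=> FG; congr cintegral; apply/funext. Qed.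

Lemma sphere_functional_sqnorm F :
  sphere_functional (sqnorm_poly * F) = sphere_functional F.
Proof.
by apply: sphere_functional_ext => z; rewrite eval_sphereM eval_sphere_sqnorm mul1r.
Qed.

Hypothesis hsigma : rotation_invariant sigma.

(** The integral of the generator is, up to a factor i, a sesquilinear form evaluated at the unit
    vector v; polarization extracts its coefficients. *)
Lemma sphere_functional_rotation k j F :
  sphere_functional (zv k * dz j F - zbv j * dzb k F) = 0.
Proof.
pose B k l := sphere_functional (zv k * dz l F - zbv l * dzb k F).
apply: (@hermitian_polarization R n B) => v /(cintegral_rotation_generator).
move=> /(_ _ hsigma F); rewrite -[cintegral _ _]/(sphere_functional _) linearZ /= => /eqP.
rewrite mulf_eq0 => /orP[|/eqP L0].
  by rewrite eq_complex /= oner_eq0 andbF.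
rewrite -[RHS]L0 linear_sum; apply: eq_bigr => k' _; rewrite linear_sum; apply: eq_bigr => l _.
by rewrite linearZ.
Qed.

End invariant_integral.

(** * Spectral decomposition on the sphere *)

(** Groups terms by key; it removes all bidegrees outside Omega at once. *)
Lemma sum_fibers_eq0 (V : nmodType) (T K : eqType) (s : seq T) (key : T -> K)
    (f : T -> V) (Q : pred K) :
  (forall y, Q y -> \sum_(x <- s | key x == y) f x = 0) ->
  \sum_(x <- s | Q (key x)) f x = 0.
Proof.
move=> h; pose u := undup [seq key x | x <- s].
transitivity (\sum_(x <- s | Q (key x)) \sum_(y <- u | y == key x) f x).
  rewrite [LHS]big_seq_cond [RHS]big_seq_cond; apply: eq_bigr => x /andP[xs _].
  rewrite -big_filter (_ : [seq y <- u | y == key x] = [:: key x]) ?big_seq1 //.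
  by apply: filter_pred1_uniq; rewrite ?undup_uniq // mem_undup map_f.
rewrite (exchange_big_dep Q) /= => [|x y Qx /eqP -> //].
rewrite big1_seq // => y /andP[Qy _]; rewrite -[RHS](h y Qy); apply: eq_bigl => x.
by rewrite eq_sym; case: eqP => [->|]; rewrite ?andbF ?Qy.
Qed.

Section expansion.
Context {R : realType} {n : nat}.
Notation C := R[i].
Notation S := (sphere R n).
Notation poly2 := (mpoly (n.+1 + n.+1) C).
Implicit Types (F G P : poly2) (Omega : set (nat * nat)).


(** Decompose each monomial; the powers of |z|^2 become 1 on the sphere. A bidegree may occur
    several times in [s]. *)
Lemma harmonic_expansion F : exists s : seq (nat * nat * poly2),
  (forall x, x \in s -> bihomogeneous x.1.1 x.1.2 x.2 /\ lapz x.2 = 0) /\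
  forall z : S, eval_sphere F z = eval_sphere (\sum_(x <- s) x.2) z.
Proof.
elim/mpolyind: F => [|c m F _ _ [s [hs eF]]]; first by exists [::]; split=> // z; rewrite big_nil.
have [h [hh eX]] := harmonic_decomposition (@bihomogeneousX R n m).
move: hh eX; set p := (\sum_(j < n.+1) m (lshift n.+1 j))%N.
set q := (\sum_(j < n.+1) m (rshift n.+1 j))%N => hh eX.
exists ([seq ((p - k, q - k)%N, c *: h k) | k <- index_iota 0 (minn p q).+1] ++ s); split=> [x|z].
  rewrite mem_cat => /orP[/mapP[k]|]; last exact: hs.
  rewrite mem_index_iota ltnS => /andP[_ /hh[h1 h2]] -> /=; split; first exact: bihomogeneousZ.
  by rewrite linearZ /= h2 scaler0.
rewrite big_cat !eval_sphereD -eF; congr (_ + _).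
rewrite big_map big_mkord eX scaler_sumr.
rewrite !eval_sphere_sum !fct_sumE; apply: eq_bigr => k _.
rewrite !eval_sphereZ eval_sphereM (_ : eval_sphere _ z = 1) ?mul1r //.
elim: (k : nat) => [|k' IH]; first by rewrite expr0 -mpolyC1 eval_sphereC.
by rewrite exprS eval_sphereM eval_sphere_sqnorm mul1r IH.
Qed.

Lemma E_zero Omega : E R n Omega (fun=> 0).
Proof.
exists 0%N, (fun _ _ => 0); split; first by case.
by rewrite big_ord0.
Qed.

Lemma E_add Omega f g : E R n Omega f -> E R n Omega g -> E R n Omega (fun x => f x + g x).
Proof.
move=> [k [h [hh ->]]] [k' [h' [hh' ->]]].
exists (k + k')%N, (fun i => match fintype.split i with inl j => h j | inr j => h' j end).
split=> [i|]; first by case: (fintype.split i).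
apply/funext => x; rewrite big_split_ord /= !fct_sumE; congr (_ + _); apply: eq_bigr => i _.
  by rewrite -[lshift _ i]/(unsplit (inl i)) unsplitK.
by rewrite -[rshift _ i]/(unsplit (inr i)) unsplitK.
Qed.

Lemma H_scale p q c f : H R n p q f -> H R n p q (fun x => c * f x).
Proof.
move=> [P [P1 P2 ->]]; exists (c *: P); split; first exact: bihomogeneousZ.
  rewrite to_xyZ /laplacian; under eq_bigr do rewrite !mderivZ.
  by rewrite -scaler_sumr -/(laplacian _) P2 scaler0.
by rewrite eval_sphereZ.
Qed.

Lemma E_scale Omega c f : E R n Omega f -> E R n Omega (fun x => c * f x).
Proof.
move=> [k [h [hh ->]]]; exists k, (fun i x => c * h i x); split.
  by move=> i; have [pq Opq Hpq] := hh i; exists pq => //; exact: H_scale.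
by apply/funext => x; rewrite !fct_sumE mulr_sumr.
Qed.

Lemma H_E Omega pq f : Omega pq -> H R n pq.1 pq.2 f -> E R n Omega f.
Proof.
move=> Opq Hf; exists 1%N, (fun=> f); split; first by move=> _; exists pq.
by rewrite big_ord1.
Qed.

Lemma E_polynomial Omega f : E R n Omega f -> exists k (P : 'I_k -> poly2),
  (forall i, exists2 pq, Omega pq &
     bihomogeneous pq.1 pq.2 (P i) /\ laplacian (to_xy (P i)) = 0) /\
  f = eval_sphere (\sum_i P i).
Proof.
move=> [k [h [hh ->]]].
have /choice[P hP] : forall i, exists P : poly2, (exists2 pq, Omega pq &
     bihomogeneous pq.1 pq.2 P /\ laplacian (to_xy P) = 0) /\ h i = eval_sphere P.
  by move=> i; have [pq Opq [P [P1 P2 ->]]] := hh i; exists P; split=> //; exists pq.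
exists k, P; split=> [i|]; first exact: (hP i).1.
by rewrite eval_sphere_sum; apply: eq_bigr => i _; exact: (hP i).2.
Qed.

Variable sigma : probability S R.
Hypothesis hsigma : rotation_invariant sigma.
Notation L := (sphere_functional sigma).

Lemma cintegral_eval_mulB F P G :
  cintegral sigma (fun z => (eval_sphere F z - eval_sphere P z) * eval_sphere G z) =
  L (F * G) - L (P * G).
Proof.
rewrite -linearB /= -mulrBl /sphere_functional; congr cintegral; apply/funext => z.
by rewrite eval_sphereM eval_sphereB.
Qed.

(** The exceptional bidegree is (q, p) because conjugation, absent from the pairing, exchanges
    H(p,q) and H(q,p). *)
Lemma harmonic_orthogonal p q p' q' F G :
  bihomogeneous p q F -> laplacian (to_xy F) = 0 ->
  bihomogeneous p' q' G -> laplacian (to_xy G) = 0 -> (p', q') != (q, p) ->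
  L (F * G) = 0.
Proof.
move=> hF F0 hG G0 ne.
have L0 P Q : laplacian (to_xy Q) = 0 -> L (P * lapz Q) = 0.
  move=> Q0; rewrite -[RHS](linear0 (sphere_functional sigma)).
  apply: sphere_functional_ext => z; rewrite eval_sphereM lapz_harmonic // mulr0.
  by rewrite -mpolyC0 eval_sphereC.
apply: (functional_orthogonal (L := sphere_functional sigma) _ _ hF hG _ _ ne).
- exact: sphere_functional_sqnorm.
- exact: sphere_functional_rotation.
- exact: L0.
- exact: L0.
Qed.

Lemma E_orthogonal Omega e p q G : E R n Omega e ->
  bihomogeneous p q G -> laplacian (to_xy G) = 0 -> ~ Omega (q, p) ->
  cintegral sigma (fun z => e z * eval_sphere G z) = 0.
Proof.
move=> /E_polynomial[k [P [hP ->]]] hG G0 npq.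
transitivity (L ((\sum_i P i) * G)).
  by rewrite /sphere_functional eval_sphereM.
rewrite mulr_suml linear_sum big1 // => i _; have [[p' q'] Opq [P1 P2]] := hP i.
apply: (harmonic_orthogonal P1 P2 hG G0) => /=; apply: contra_notN npq.
by move=> /eqP[-> ->].
Qed.

(* The components of [F] in the spaces [H p q] with [(p, q)] outside [Omega]
   integrate to 0 against every polynomial, hence vanish. *)
Lemma approximable_in_E Omega F :
  (forall G (eps : C), 0 < eps -> exists2 e, E R n Omega e &
     `|cintegral sigma (fun z => (eval_sphere F z - e z) * eval_sphere G z)| < eps) ->
  E R n Omega (eval_sphere F).
Proof.
move=> approx; have [s [hs eF]] := harmonic_expansion F.
have harm (x : nat * nat * poly2) : x \in s -> laplacian (to_xy x.2) = 0.
  by move=> /hs[_ /harmonic_lapz].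
(* For a bidegree outside Omega it is the sum of its terms that must vanish, not each term. *)
pose fiber y := \sum_(x <- s | x.1 == y) x.2.
have fiber_bihom y : bihomogeneous y.1 y.2 (fiber y).
  rewrite /fiber big_seq_cond; apply: bihomogeneous_sum => x /andP[xs /eqP <-].
  by have [] := hs x xs.
have fiber_lapz y : lapz (fiber y) = 0.
  by rewrite /fiber linear_sum big_seq_cond big1 // => x /andP[/hs[]].
have fiber0 y : ~ Omega y -> fiber y = 0.
  case: y => p q npq; apply: (functional_nondegenerate (L := sphere_functional sigma)
    _ _ (sphere_functional1 sigma) (fiber_bihom (p, q))).
  - exact: sphere_functional_sqnorm.
  - exact: sphere_functional_rotation.
  move=> G; have [t [ht eG]] := harmonic_expansion G.
  transitivity (L (fiber (p, q) * \sum_(x <- t) x.2)).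
    by apply: sphere_functional_ext => z; rewrite !eval_sphereM eG.
  rewrite mulr_sumr linear_sum big1_seq // => -[[p' q'] P] /andP[_ /ht[/= hP /harmonic_lapz P0]].
  (* Only harmonic P of bidegree (q, p) can detect the fiber, and against such P the other
     components of F integrate to 0. *)
  have [[e1 e2]|ne] := eqVneq (p', q') (q, p); last first.
    exact: (harmonic_orthogonal (fiber_bihom (p, q)) (harmonic_lapz (fiber_lapz (p, q))) hP P0 ne).
  rewrite {}e1 {}e2 in hP.
  transitivity (L (F * P)).
    transitivity (L ((\sum_(x <- s) x.2) * P)); last first.
      by apply: sphere_functional_ext => z; rewrite !eval_sphereM eF.
    rewrite [in RHS](bigID (fun x => x.1 == (p, q))) /= mulrDl linearD /=.
    rewrite [X in _ + X](_ : _ = 0) ?addr0 //.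
    rewrite mulr_suml linear_sum big_seq_cond big1 // => x /andP[xs nx].
    apply: (harmonic_orthogonal (hs x xs).1 (harm x xs) hP P0).
    by apply: contraNneq nx => -[-> ->]; rewrite -surjective_pairing.
  (* Elements of E_Omega integrate to 0 against P, so none approximates F within |L(F P)| unless
     this number is 0. *)
  apply/eqP/negPn/negP => nz.
  have [|e Ee] := approx P `|L (F * P)|; first by rewrite normr_gt0.
  rewrite (_ : cintegral _ _ = L (F * P)) ?ltxx //.
  have e0 := E_orthogonal Ee hP P0 npq.
  have [k [Q [_ eQ]]] := E_polynomial Ee.
  rewrite eQ cintegral_eval_mulB -[RHS]subr0; congr (_ - _).
  by move: e0; rewrite eQ /sphere_functional eval_sphereM.
have -> : eval_sphere F = eval_sphere (\sum_(x <- s | x.1 \in Omega) x.2).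
  apply/funext => z; rewrite eF (bigID (fun x => x.1 \in Omega)) /= eval_sphereD.
  rewrite [X in _ + eval_sphere X z](_ : _ = 0) ?addr0.
    by rewrite -mpolyC0 eval_sphereC addr0.
  apply: (sum_fibers_eq0 (Q := fun y => y \notin Omega)) => y yO; apply: fiber0.
  by move/mem_set; exact/negP.
rewrite eval_sphere_sum big_seq_cond.
apply: (big_ind (E R n Omega)); [exact: E_zero|exact: E_add|].
move=> x /andP[xs /set_mem xO]; apply: (H_E xO).
by exists x.2; split=> //; [exact: (hs x xs).1|exact: harm].
Qed.

Lemma E_cmeasurable Omega f : E R n Omega f -> bounded_cmeasurable f.
Proof. by move=> /E_polynomial[k [P [_ ->]]]; exact: bounded_cmeasurable_eval_sphere. Qed.

End expansion.

(** * The weak-star topology *)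

Section Lp_products.
Context {R : realType} d (T : measurableType d) (mu : probability T R).
Notation C := R[i].
Implicit Types f g : T -> C.

Lemma normc_ge0 (x : C) : 0 <= Normc.normc x.
Proof. exact: le_trans (normr_ge0 _) (normr_Re_le _). Qed.

Lemma LinftyP f : Lp mu +oo f <->
  cmeasurable f /\ exists M : R, \forall x \ae mu, Normc.normc (f x) <= M.
Proof.
have E : ('N[mu]_+oo[ (fun x => (Normc.normc (f x))%:E) ])%E =
    ess_sup mu (fun x => (Normc.normc (f x))%:E).
  (* The norm of exponent +oo is the essential supremum only when the total mass is positive. *)
  rewrite unlock [X in (0 < X)%E](@probability_setT _ _ _ mu) lte01.
  by congr ess_sup; apply/funext => x /=; rewrite ger0_norm ?normc_ge0.
split=> [[f1 f2]|[[f1 f2] [M hM]]].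
  rewrite E => fy; split=> //.
  have f0 : (0 <= ess_sup mu (fun x => (Normc.normc (f x))%:E))%E.
    by rewrite -E Lnorm_ge0.
  exists (fine (ess_sup mu (fun x => (Normc.normc (f x))%:E))).
  have : (ess_sup mu (fun x => (Normc.normc (f x))%:E) <=
      (fine (ess_sup mu (fun x => (Normc.normc (f x))%:E)))%:E)%E.
    by rewrite fineK // ge0_fin_numE.
  by move/ess_supP; apply: filterS => x; rewrite lee_fin.
split=> //; rewrite E; apply: (@le_lt_trans _ _ M%:E); last exact: ltry.
by apply/ess_supP; apply: filterS hM => x; rewrite lee_fin.
Qed.

Lemma L1P f : Lp mu 1%:E f <->
  cmeasurable f /\ mu.-integrable [set: T] (fun x => (Normc.normc (f x))%:E).
Proof.
split=> [[f1 f2 f3]|[[f1 f2] /integrableP[_ fi]]].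
  split=> //; apply/integrableP; split; last by rewrite -Lnorm1.
  exact/measurable_EFinP/measurable_normc.
by split=> //; rewrite Lnorm1.
Qed.

Lemma L1_cintegrable f : Lp mu 1%:E f -> cintegrable mu f.
Proof. by move=> /L1P[mf fi]; exact: cintegrable_norm. Qed.

Lemma bounded_Linfty f : bounded_cmeasurable f -> Lp mu +oo f.
Proof.
move=> [mf [M hM]]; apply/LinftyP; split=> //; exists M; exact: aeW.
Qed.

Lemma Linfty_L1 f : Lp mu +oo f -> Lp mu 1%:E f.
Proof.
move=> /LinftyP[mf [M hM]]; apply/L1P; split=> //; apply/integrableP; split.
  exact/measurable_EFinP/measurable_normc.
apply: (@le_lt_trans _ _ (\int[mu]_x `|M%:E|)%E); last first.
  rewrite integral_cst // [X in (_ * X)%E](@probability_setT _ _ _ mu) mule1.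
  exact: ltry.
apply: ae_ge0_le_integral => //.
- by apply: measurableT_comp => //; exact/measurable_EFinP/measurable_normc.
apply: filterS hM => x hx _; rewrite /= lee_fin ger0_norm ?normc_ge0 //.
exact: le_trans hx (ler_norm M).
Qed.

Lemma Linfty_mul_L1 f g : Lp mu +oo f -> Lp mu 1%:E g -> Lp mu 1%:E (fun x => f x * g x).
Proof.
move=> /LinftyP[mf [M hM]] /L1P[mg ig]; apply/L1P.
have mfg := cmeasurableM mf mg; split=> //; apply/integrableP; split.
  exact/measurable_EFinP/measurable_normc.
have iM : mu.-integrable [set: T] (fun x => (`|M|%:E * (Normc.normc (g x))%:E)%E).
  exact: (integrableZl measurableT).
have /integrableP[_] := iM; apply: le_lt_trans.
apply: ae_ge0_le_integral => //.
- by apply: measurableT_comp => //; exact/measurable_EFinP/measurable_normc.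
- by apply: measurableT_comp => //; exact: (measurable_int mu).
apply: filterS hM => x hx _; rewrite /= Normc.normcM lee_fin !normrM normr_id.
rewrite ler_pM // ger0_norm ?normc_ge0 //; exact: le_trans hx (ler_norm M).
Qed.

Lemma Linfty_mul f g : Lp mu +oo f -> Lp mu +oo g -> Lp mu +oo (fun x => f x * g x).
Proof.
move=> /LinftyP[mf [M hM]] /LinftyP[mg [N hN]]; apply/LinftyP.
split; first exact: cmeasurableM.
exists (M * N); apply: filterS2 hM hN => x hx hy.
by rewrite Normc.normcM ler_pM ?normc_ge0.
Qed.

Lemma Linfty_add f g : Lp mu +oo f -> Lp mu +oo g -> Lp mu +oo (fun x => f x + g x).
Proof.
move=> /LinftyP[mf [M hM]] /LinftyP[mg [N hN]]; apply/LinftyP.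
split; first exact: cmeasurableD.
exists (M + N); apply: filterS2 hM hN => x hx hy.
apply: le_trans (lerD hx hy).
by rewrite -lecR rmorphD /= -!norm_normc ler_normD.
Qed.

Notation Linfty := (set_type (Lp mu +oo)).
Notation L1 := (set_type (Lp mu 1%:E)).
Notation W := (initial_topology (@pairing d T R mu)).

Lemma continuous_pairing (g : L1) :
  continuous (fun f : W => (pairing f g : C)).
Proof.
move=> f; apply: (@continuous_comp W _ _ (@pairing d T R mu : W -> _) (fun u => u g)).
  exact: initial_continuous.
exact: (@proj_continuous L1 (fun=> C) g).
Qed.

Lemma weak_star_closure_approx (A : set (T -> C)) f (g : T -> C) (eps : C) :
  weak_star_closure mu A f -> Lp mu 1%:E g -> 0 < eps ->
  exists2 a, A a & Lp mu +oo a /\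
    `|cintegral mu (fun x => f x * g x) - cintegral mu (fun x => a x * g x)| < eps.
Proof.
move=> [F clF <-] Lg eps0; pose G : L1 := SigSub (mem_set Lg).
have nF : nbhs (F : W) [set F' : W | `|(pairing F G : C) - pairing F' G| < eps].
  apply: (@continuous_pairing G F [set y : C | `|(pairing F G : C) - y| < eps]).
  by apply/(nbhs_ballP (pairing F G : C)); exists eps => // y; rewrite -ball_normE.
have [a [Aa ha]] := clF _ nF.
by exists (set_val a) => //; split=> //; exact: (set_mem (valP a)).
Qed.

Lemma weak_star_closure_sub (A : set (T -> C)) :
  (forall f, A f -> Lp mu +oo f) -> A `<=` weak_star_closure mu A.
Proof.
move=> AL f Af; pose F : Linfty := SigSub (mem_set (AL f Af)).
by exists F => //; exact: subset_closure.
Qed.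

(* The hypothesis on [phi], an affine adjoint on [L^1], makes it weak-star
   continuous. *)
Lemma weak_star_closure_map (A : set (T -> C)) (phi : (T -> C) -> T -> C) :
  (forall f, Lp mu +oo f -> Lp mu +oo (phi f)) ->
  (forall g, Lp mu 1%:E g -> exists c (g' : T -> C), Lp mu 1%:E g' /\
     forall f, Lp mu +oo f ->
       cintegral mu (fun x => phi f x * g x) = c + cintegral mu (fun x => f x * g' x)) ->
  (forall a, A a -> Lp mu +oo a -> weak_star_closure mu A (phi a)) ->
  forall f, weak_star_closure mu A f -> weak_star_closure mu A (phi f).
Proof.
move=> phiL adj phiA f [F clF <-].
pose Phi (F : W) : W := SigSub (mem_set (phiL _ (set_mem (valP (F : Linfty))))).
have cPhi : continuous Phi.
  apply: (@continuous_comp_initial _ W _ (@pairing d T R mu) Phi) => F'.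
  have FF : Filter ((@pairing d T R mu \o Phi) @ F').
    exact: (@fmap_filter W _ _ _ (nbhs_filter F')).
  (* The pointwise topology is a supremum over test functions, so continuity is checked against one
     G at a time. *)
  apply: (cvg_sup _ _ FF).2 => G.
  have [c [g' [Lg' hg']]] := adj _ (set_mem (valP G)).
  pose G' : L1 := SigSub (mem_set Lg').
  have e F'' : pairing (Phi F'') G = c + (pairing F'' G' : C).
    exact: (hg' _ (set_mem (valP (F'' : Linfty)))).
  have cG : continuous (fun F'' : W => (pairing (Phi F'') G : C)).
    rewrite (_ : (fun F'' : W => _) = (fun F'' : W => c + (pairing F'' G' : C))).
      apply: continuous_complexD; first by move=> x; exact: (@cst_continuous W C c x).
      exact: continuous_pairing.
    by apply/funext => F''; exact: e.
  exact: (@continuous_comp_initial _ W C (fun u : {ptws L1 -> C} => u G)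
    (fun F'' => pairing (Phi F'')) cG F').
exists (Phi F) => //.
(* [phiA] only places the image of A in the closure of A, so the image of F is first found in the
   closure of that closure. *)
rewrite -[closure _]/(closure (set_val @^-1` A : set W)).
apply: (@closed_closure W (set_val @^-1` A)).
move=> B nB; have [a [Aa Ba]] := clF _ (cPhi _ _ nB).
have [b cb eb] := phiA _ Aa (set_mem (valP (a : Linfty))).
exists (Phi a); split=> //.
by have -> : Phi a = b by apply/val_inj; exact: (esym eb).
Qed.

End Lp_products.

(** * Algebra patterns *)

Section algebra_patterns.
Context {R : realType} {n : nat}.
Notation C := R[i].
Notation S := (sphere R n).
Implicit Types (Omega : set (nat * nat)).

Definition product_closed (A : set (S -> C)) : Prop :=
  forall f g, A f -> A g -> A (fun x => f x * g x).

Lemma uniform_closureP (A : set (S -> C)) f :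
  closure (A : set {uniform S -> C}) f <->
  forall eps : C, 0 < eps -> exists2 a, A a & forall z, `|f z - a z| < eps.
Proof.
split=> [clf eps eps0|approx B /uniform_nbhs[V [+ hB]]].
  have [|a [Aa ha]] := clf [set a | forall z, `|f z - a z| < eps].
    apply/uniform_nbhs; exists [set xy : C * C | ball xy.1 eps xy.2]; split.
      by exists eps => // -[x y]; rewrite -ball_normE.
    by move=> a /= ha z; have := ha z I; rewrite -ball_normE.
  by exists a.
rewrite -entourage_ballE => -[eps eps0 hV].
have [a Aa ha] := approx eps eps0; exists a; split=> //; apply: hB => z _.
by apply: hV; rewrite /= -ball_normE; exact: ha.
Qed.

Lemma E_continuous Omega f : E R n Omega f -> continuous f.
Proof. by move=> /E_polynomial[k [P [_ ->]]]; exact: continuous_eval_sphere. Qed.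

Lemma E_bounded Omega f : E R n Omega f ->
  exists2 M : C, 0 <= M & forall z, `|f z| <= M.
Proof. by move=> /E_polynomial[k [P [_ ->]]]; exact: bounded_eval_sphereC. Qed.

Lemma product_closed_C_pattern Omega :
  product_closed (E R n Omega) -> C_algebra_pattern R n Omega.
Proof.
move=> EM; split.
- split; first by move=> x; exact: (@cst_continuous S C 0 x).
  by apply: subset_closure; exact: E_zero.
- move=> f g [cf /uniform_closureP clf] [cg /uniform_closureP clg].
  split; first exact: (continuous_complexD cf cg).
  apply/uniform_closureP => eps eps0; have e2 : 0 < eps / 2%:R by rewrite divr_gt0.
  have [a Ea ha] := clf _ e2; have [b Eb hb] := clg _ e2.
  exists (fun x => a x + b x) => [|z]; first exact: E_add.
  rewrite (_ : f z + g z - _ = (f z - a z) + (g z - b z)); last by ring.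
  apply: le_lt_trans (ler_normD _ _) _.
  by rewrite [eps]splitr ltrD.
- move=> c f [cf /uniform_closureP clf].
  split; first exact: (continuous_complexM (fun x => @cst_continuous S C c x) cf).
  apply/uniform_closureP => eps eps0.
  have c1 : 0 < `|c| + 1 by rewrite ltr_wpDl.
  have [|a Ea ha] := clf (eps / (`|c| + 1)); first by rewrite divr_gt0.
  exists (fun x => c * a x) => [|z]; first exact: E_scale.
  rewrite -mulrBr normrM; have := ha z; rewrite ltr_pdivlMr // mulrC.
  by apply: le_lt_trans; rewrite ler_wpM2r // lerDl.
move=> f g [cf /uniform_closureP clf] [cg /uniform_closureP clg].
split; first exact: (continuous_complexM cf cg).
apply/uniform_closureP => eps eps0.
(* [a0] bounds f by M + 1 without compactness of the sphere. Then b is chosen before a, whose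
   tolerance depends on the bound of b. *)
have [a0 Ea0 ha0] := clf 1 ltr01; have [M M0 hM] := E_bounded Ea0.
have fM z : `|f z| <= M + 1.
  rewrite -[f z](subrK (a0 z)) addrC; apply: le_trans (ler_normD _ _) _.
  by rewrite lerD // ltW.
have M1 : 0 < M + 1 by rewrite ltr_wpDl.
have [|b Eb hb] := clg (eps / 2%:R / (M + 1)); first by rewrite !divr_gt0.
have [N N0 hN] := E_bounded Eb; have N1 : 0 < N + 1 by rewrite ltr_wpDl.
have [|a Ea ha] := clf (eps / 2%:R / (N + 1)); first by rewrite !divr_gt0.
exists (fun x => a x * b x) => [|z]; first exact: EM.
rewrite (_ : f z * g z - _ = f z * (g z - b z) + (f z - a z) * b z); last by ring.
apply: le_lt_trans (ler_normD _ _) _; rewrite !normrM [eps]splitr ltrD //.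
  have := hb z; rewrite ltr_pdivlMr // mulrC; apply: le_lt_trans.
  by rewrite ler_wpM2r.
have := ha z; rewrite ltr_pdivlMr //; apply: le_lt_trans.
by rewrite ler_wpM2l // (le_trans (hN z)) // lerDl.
Qed.

Variable sigma : probability S R.

(** With separate continuity only, each operation is extended in two passes: one argument in E_Omega
    and the other in the closure, then both in the closure. *)
Lemma product_closed_Linfty_pattern Omega :
  product_closed (E R n Omega) -> Linfty_algebra_pattern sigma Omega.
Proof.
move=> EM; set W := weak_star_closure sigma (E R n Omega).
have EL f : E R n Omega f -> Lp sigma +oo f.
  by move=> /E_cmeasurable; exact: bounded_Linfty.
have EW : E R n Omega `<=` W := weak_star_closure_sub EL.
have WL f : W f -> Lp sigma +oo f by move=> [F _ <-]; exact: (set_mem (valP F)).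
have cL c : Lp sigma +oo (fun=> c) by exact/bounded_Linfty/bounded_cmeasurable_cst.
have cintegral0 : cintegral sigma (fun=> 0) = 0.
  by rewrite /cintegral !Rintegral_cst // mul0r.
have addW f : (forall a, E R n Omega a -> W (fun x => f x + a x)) -> Lp sigma +oo f ->
    forall g, W g -> W (fun x => f x + g x).
  move=> fE fL; apply: weak_star_closure_map => [g gL|g gL|a Ea _].
  - exact: Linfty_add.
  (* Translation by f is affine, with this constant term; for multiplication by f the adjoint sends
     g to f g, again in L^1. *)
  - exists (cintegral sigma (fun x => f x * g x)), g; split=> // h hL.
    under [X in cintegral _ X = _]funext do rewrite mulrDl.
    by rewrite cintegralD //; apply: L1_cintegrable; exact: Linfty_mul_L1.
  exact: fE.
have mulW f : (forall a, E R n Omega a -> W (fun x => f x * a x)) -> Lp sigma +oo f ->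
    forall g, W g -> W (fun x => f x * g x).
  move=> fE fL; apply: weak_star_closure_map => [g gL|g gL|a Ea _].
  - exact: Linfty_mul.
  - exists 0, (fun x => f x * g x); split=> [|h hL]; first exact: Linfty_mul_L1.
    by rewrite add0r; congr cintegral; apply/funext => x; ring.
  exact: fE.
split.
- by apply: EW; exact: E_zero.
- move=> f g Wf Wg; apply: (addW f _ (WL _ Wf) g Wg) => a Ea.
  rewrite (_ : (fun x => _) = fun x => a x + f x); last by apply/funext => x; rewrite addrC.
  apply: (addW a _ (EL _ Ea) f Wf) => b Eb; apply: EW; exact: E_add.
- move=> c f Wf; apply: (mulW (fun=> c)) => // a Ea; apply: EW; exact: E_scale.
move=> f g Wf Wg; apply: (mulW f _ (WL _ Wf) g Wg) => a Ea.
rewrite (_ : (fun x => _) = fun x => a x * f x); last by apply/funext => x; rewrite mulrC.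
by apply: (mulW a _ (EL _ Ea) f Wf) => b Eb; apply: EW; exact: EM.
Qed.

Hypothesis hsigma : rotation_invariant sigma.

Lemma C_pattern_product_closed Omega :
  C_algebra_pattern R n Omega -> product_closed (E R n Omega).
Proof.
move=> [_ _ _ clM] f g Ef Eg.
have sub h : E R n Omega h -> uniform_closure (E R n Omega) h.
  by move=> Eh; split; [exact: E_continuous Eh|exact: subset_closure].
have [_ /uniform_closureP cl] := clM _ _ (sub _ Ef) (sub _ Eg).
have [kP [P [_ fP]]] := E_polynomial Ef; have [kQ [Q [_ gQ]]] := E_polynomial Eg.
move: cl; rewrite fP gQ -eval_sphereM => cl.
apply: (approximable_in_E hsigma) => G eps eps0.
have [M hM] := bounded_eval_sphere (n := n) G.
have epsR : eps = (complex.Re eps)%:C by rewrite RRe_real // gtr0_real.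
set e := complex.Re eps in epsR; have e0 : 0 < e by rewrite -ltcR -epsR.
have M1 : 0 < `|M| + 1 by rewrite ltr_wpDl.
(* With the factor 2 of [normc_cintegral_le] the integral is at most e/2; adding 1 to |M| keeps the
   divisor positive. *)
pose d := e / (`|M| + 1) / 4%:R.
have d0 : 0 < d by rewrite !divr_gt0.
have [|a Ea ha] := cl d%:C; first by rewrite ltcR.
exists a => //.
have bfG : bounded_cmeasurable
    (fun z : S => (eval_sphere ((\sum_i P i) * (\sum_i Q i)) z - a z) * eval_sphere G z).
  apply: bounded_cmeasurableM; last exact: bounded_cmeasurable_eval_sphere.
  have [ka [A [_ ->]]] := E_polynomial Ea.
  by rewrite -eval_sphereB; exact: bounded_cmeasurable_eval_sphere.
have fb (z : S) : Normc.normc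
    ((eval_sphere ((\sum_i P i) * (\sum_i Q i)) z - a z) * eval_sphere G z) <=
    d * (`|M| + 1).
  have h1 : Normc.normc (eval_sphere ((\sum_i P i) * (\sum_i Q i)) z - a z) <= d.
    by rewrite -lecR -norm_normc eval_sphereM; exact/ltW/ha.
  have h2 : Normc.normc (eval_sphere G z) <= `|M| + 1.
    by apply: le_trans (hM z) _; rewrite (le_trans (ler_norm M)) // lerDl.
  rewrite Normc.normcM; exact: (ler_pM (normc_ge0 _) (normc_ge0 _) h1 h2).
rewrite norm_normc epsR ltcR.
apply: le_lt_trans (normc_cintegral_le sigma bfG fb) _.
rewrite /d mulrAC divfK ?gt_eqF // mulr2n; lra.
Qed.

Lemma Linfty_pattern_product_closed Omega :
  Linfty_algebra_pattern sigma Omega -> product_closed (E R n Omega).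
Proof.
move=> [_ _ _ clM] f g Ef Eg.
have sub := @weak_star_closure_sub R _ _ sigma (E R n Omega)
  (fun f Ef => bounded_Linfty sigma (E_cmeasurable Ef)).
have cl := clM _ _ (sub _ Ef) (sub _ Eg).
have [kP [P [_ fP]]] := E_polynomial Ef; have [kQ [Q [_ gQ]]] := E_polynomial Eg.
move: cl; rewrite fP gQ -eval_sphereM => cl.
apply: (approximable_in_E hsigma) => G eps eps0.
have GL : Lp sigma 1%:E (eval_sphere G).
  exact/Linfty_L1/bounded_Linfty/bounded_cmeasurable_eval_sphere.
have [a Ea [_ ha]] := weak_star_closure_approx cl GL eps0.
exists a => //; move: ha; have [ka [A [_ ->]]] := E_polynomial Ea.
by rewrite cintegral_eval_mulB /sphere_functional !eval_sphereM.
Qed.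

End algebra_patterns.

Theorem theorem4p7 (R : realType) (n : nat)
    (sigma : probability (sphere R n) R) (hsigma : rotation_invariant sigma)
    (Omega : set (nat * nat)) :
  C_algebra_pattern R n Omega <-> Linfty_algebra_pattern sigma Omega.
Proof.
split=> [/(C_pattern_product_closed hsigma)|/(Linfty_pattern_product_closed hsigma)].
  exact: product_closed_Linfty_pattern.
exact: product_closed_C_pattern.
Qed.
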